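(* Let $d\ge 2$ be an integer and let $\lambda\in\Lambda$. (i) If $\rho>\rho_c$, then $E_{\lambda,\rho}|\mathcal B|<\infty$. (ii) If $\rho=\rho_c$, then $E_{\lambda,\rho}|\mathcal B|=\infty$.
   Context: Chase-escape with death (CED) with parameters $\lambda>0$ (spreading rate) and $\rho>0$ (death rate) on a graph is the continuous-time Markov process in which every vertex is in one of the states $w$ (white), $r$ (red), $b$ (blue), $\dagger$ (dead), with the following independent transitions: for each edge with one endpoint red and the other white, the white endpoint becomes red at rate $\lambda$; for each edge with one endpoint blue and the other red, the red endpoint becomes blue at rate $1$; each red vertex becomes dead at rate $\rho$. Blue and dead vertices never change state. The graph considered is the infinite rooted $d$-ary tree $\mathbb T_d$ (every vertex has $d$ children) with one extra vertex $\mathfrak b$ attached to the root. Initially $\mathfrak b$ is blue, the root is red, and all other vertices are white. $P_{\lambda,\rho}$ and $E_{\lambda,\rho}$ denote probability and expectation for this process. Let $\mathcal B$ be the set of vertices that are ever blue and $B=\{|\mathcal B|=\infty\}$. Define $\rho_c=\rho_c(d,\lambda)=\inf\{\rho>0: P_{\lambda,\rho}(B)=0\}$. Let $\lambda_c^{\pm}=2d-1\pm 2\sqrt{d^2-d}$ and $\Lambda=(\lambda_c^-,\lambda_c^+)$. (For $\lambda\in\Lambda$ one has $\rho_c>0$.) *)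

(* Defs.v *)
From HB Require Import structures.
From mathcomp Require Import all_boot all_order all_algebra.
From mathcomp Require Import all_classical all_reals all_analysis.
From mathcomp Require Import measurable_realfun.

Set Implicit Arguments.
Unset Strict Implicit.
Unset Printing Implicit Defensive.

Import Order.TTheory GRing.Theory Num.Theory.
Import numFieldNormedType.Exports.

Local Open Scope classical_set_scope.
Local Open Scope ring_scope.

(* Continuous-time Markov (jump) processes whose states are the C-colourings  *)
(* of V, given by transition rates Q x y (x <> y) and a deterministic start   *)
(* x0, described in the usual way by the jump chain and the holding times.    *)
Section MarkovJumpProcess.
Context {R : realType} {V : Type} {C : choiceType}.
Local Notation state := (V -> C).
Implicit Types (Q : state -> state -> R) (x y : state).

(* This sum has its intended value when only finitely many y have Q x y <> 0. *)
(* For chase-escape this holds at every state with finitely many non-white    *)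
(* vertices, hence at every state that the process can visit.                 *)
Definition total_rate Q x : R := \sum_(y \in [set y | y != x]) Q x y.

(* A state with total rate 0 is absorbing. *)
Definition jump_prob Q x y : R :=
  if total_rate Q x == 0 then (y == x)%:R
  else if y == x then 0 else Q x y / total_rate Q x.

Definition jump_time {T : Type} (S : nat -> T -> \bar R) (n : nat) (w : T)
  : \bar R := (\sum_(k < n) S k w)%E.

(* Y is the jump chain and S n the time spent in its n-th state; S n = +oo is *)
(* allowed since states may be absorbing. The displayed law says that Y is a  *)
(* discrete Markov chain with matrix jump_prob Q started at x0 and that,      *)
(* given Y, the holding times are independent, S n being exponential of       *)
(* parameter total_rate Q (Y n). Measurability is for the product             *)
(* sigma-algebra on V -> C. The last clause contains non-explosion.           *)
Definition markov_jump_process {d : measure_display} {T : measurableType d}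
    (P : probability T R) Q x0 (X : R -> T -> state) : Prop :=
  exists (Y : nat -> T -> state) (S : nat -> T -> \bar R),
  [/\ forall n v c, measurable [set w | Y n w v = c],
      forall n, measurable_fun setT (S n) /\ forall w, (0 < S n w)%E,
      forall (n : nat) (y : nat -> state) (t : nat -> R),
        (forall k, 0 <= t k) ->
        P [set w | (forall k, (k < n)%N -> Y k w = y k /\ ((t k)%:E < S k w)%E)
                   /\ Y n w = y n]
        = ((y 0%N == x0)%:R *
           \prod_(k < n) (jump_prob Q (y k) (y k.+1) *
                          expR (- (total_rate Q (y k) * t k))))%:E
    & forall w t, 0 <= t -> exists n,
        (jump_time S n w <= t%:E < jump_time S n.+1 w)%E /\ X t w = Y n w].

End MarkovJumpProcess.

Inductive color := white | red | blue | dead.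

HB.instance Definition _ := gen_eqMixin color.
HB.instance Definition _ := gen_choiceMixin color.

Section ChaseEscapeWithDeath.
Context {R : realType} {V : countType}.
Variable adj : rel V.
Implicit Types (x y : V -> color) (lam rho : R).

Definition recolor x (v : V) (c : color) : V -> color :=
  fun u => if u == v then c else x u.

(* adj is symmetric, so an edge is a pair (e.1, e.2) in either orientation:   *)
(* e.1 is the endpoint that spreads and e.2 the one that changes state.       *)
Definition ced_rate lam rho x y : R :=
  \sum_(e \in [set e : V * V | [/\ adj e.1 e.2, x e.1 = red, x e.2 = white
                                  & y = recolor x e.2 red]]) lam
  + \sum_(e \in [set e : V * V | [/\ adj e.1 e.2, x e.1 = blue, x e.2 = red
                                  & y = recolor x e.2 blue]]) (1 : R)
  + \sum_(v \in [set v : V | x v = red /\ y = recolor x v dead]) rho.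

Definition ever_blue {T : Type} (X : R -> T -> V -> color) (w : T) : set V :=
  [set v | exists2 t, 0 <= t & X t w v = blue].

Definition expected_ever_blue {d : measure_display} {T : measurableType d}
    (P : probability T R) (X : R -> T -> V -> color) : \bar R :=
  (\int[P]_w counting (ever_blue X w))%E.

Definition infinitely_many_blue {T : Type} (X : R -> T -> V -> color) : set T :=
  [set w | infinite_set (ever_blue X w)].

End ChaseEscapeWithDeath.

(* The d-ary tree with one extra vertex attached to its root: Some s is the   *)
(* tree vertex s, with root Some [::] and i :: s the i-th child of s; None is *)
(* the extra vertex.                                                          *)
Definition vertex (d : nat) : countType := option (seq 'I_d).

Definition is_parent (d : nat) (u v : vertex d) : bool :=
  match v with
  | None => false
  | Some [::] => u == None
  | Some (_ :: s) => u == Some s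
  end.

Definition tree_adj (d : nat) : rel (vertex d) :=
  fun u v => is_parent u v || is_parent v u.

Definition ced_init (d : nat) (v : vertex d) : color :=
  match v with
  | None => blue
  | Some [::] => red
  | Some (_ :: _) => white
  end.

Definition is_ced {R : realType} (d : nat) (lam rho : R)
    {disp : measure_display} {T : measurableType disp} (P : probability T R)
    (X : R -> T -> vertex d -> color) : Prop :=
  markov_jump_process P (ced_rate (@tree_adj d) lam rho) (@ced_init d) X.

(* The infimum is taken in \bar R, so that it is +oo for the empty set. *)
Definition rho_c {R : realType} (d : nat)
    {disp : measure_display} {T : R -> measurableType disp}
    (P : forall rho, probability (T rho) R)
    (X : forall rho, R -> T rho -> vertex d -> color) : \bar R :=
  ereal_inf [set rho%:E | rho in
    [set rho : R | 0 < rho /\ P rho (infinitely_many_blue (X rho)) = 0%E]].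

Definition lambda_c_minus {R : realType} (d : nat) : R :=
  2 * d%:R - 1 - 2 * Num.sqrt (d%:R ^+ 2 - d%:R).

Definition lambda_c_plus {R : realType} (d : nat) : R :=
  2 * d%:R - 1 + 2 * Num.sqrt (d%:R ^+ 2 - d%:R).

(* Main.v *)
Require Import Defs.
From HB Require Import structures.
From mathcomp Require Import all_boot all_order all_algebra.
From mathcomp Require Import all_classical all_reals all_analysis.
From mathcomp Require Import measurable_realfun.
From mathcomp Require Import ring lra.

Set Implicit Arguments.
Unset Strict Implicit.
Unset Printing Implicit Defensive.

Import Order.TTheory GRing.Theory Num.Theory.
Import numFieldNormedType.Exports.

Local Open Scope classical_set_scope.
Local Open Scope ring_scope.

(** Why the theorem holds. Say that a vertex has rank [j] if the path from it
towards the root consists of [j] red vertices followed by a blue one; a red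
vertex that has no rank is cut off by a dead one and never turns blue. Call a
pair a vertex together with one of its white children, and give it the rank of
this vertex. A pair of rank [j >= 1] is destroyed at rate [1 + lam + j * rho], and it gives rise to a pair of rank
[j - 1] at rate 1 (the topmost red vertex turns blue) and to [d] pairs of rank
[j + 1] at rate [lam] (the white child turns red). So if [h] adds up weights
[w j] of all pairs, the generator of the process maps [h] to the sum over all
pairs of
  [lam * d * w (j + 1) + w (j - 1) - (1 + lam + j * rho) * w j],
the [drift] of [w], and the behaviour of the process is decided by the weights
for which this has a sign. There are three cases.

- [subcritical]: some [w >= 0] has drift at most [- lam]. Then [h] plus the sum
  of [catch_prob] over the ranks of all vertices is a supermartingale that is at
  least the number of blue vertices, hence the expectation is finite.
- [supercritical]: some [w] of finite support has a drift that is at least a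
  multiple of the rate of absolute change. Then [c / (c + h)] is a
  supermartingale for large [c], so that with positive probability there are
  always pairs that have a rank. All red vertices of a finite part of the tree
  die or turn blue, hence blue vertices occur at all depths.
- [at_least_critical]: some [w > 0] has nonnegative drift and is at most a
  multiple of [catch_prob], where [catch_prob j] is the probability that a red
  vertex of rank [j] ever turns blue. Then [h] is a submartingale and bounds
  from below, up to a factor, the expected number of blue vertices to come from
  the present red ones. This number does not tend to 0, so the expectation is
  infinite.

The recessive solution [m] of the three-term recurrence [drift m = 0], given by
a continued fraction, links these cases. If [m] is positive down to index 0,
then [rho] and all slightly smaller death rates are subcritical; otherwise the
part of [m] after its last nonpositive index shows that [rho] is at least
critical ([subcritical_or_at_least_critical]). If [rho] is at least critical,
then every smaller death rate is supercritical
([supercritical_of_lower_death]).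

If [rho > rho_c], then blue dies out for some [rho' < rho], which therefore is
not supercritical, hence [rho] is subcritical. If [rho = rho_c], then [rho] is
not subcritical, since otherwise blue would die out for some [rho' < rho], hence
[rho] is at least critical. That [rho_c] is positive, so that [rho_c] is the
death rate of one of the given processes, follows from
[supercritical_small_death]: for [lam] between [lambda_c_minus d] and
[lambda_c_plus d] all small death rates are supercritical.

All expectations are taken along the jump chain, which visits only finitely many
states within [n] steps; there they are finite sums, and a generator differs
from a one-step difference only by the positive factor of the total rate. *)

(** * The recurrence for the weights *)

Section Recurrence.
Context {R : realType}.
Implicit Types (D lam rho C : R) (w m : nat -> R) (j J : nat).

(** What one pair of rank [j] contributes to the generator of the sum of the
weights of all pairs, see [rate_sum_pairs_fun]. *)
Definition drift D lam rho w j : R :=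
  lam * D * w j.+1 + w j.-1 - (1 + lam + j%:R * rho) * w j.

(** As [drift], with all changes of weight counted in absolute value. *)
Definition turnover D lam rho w j : R :=
  lam * D * w j.+1 + `|w j.-1 - w j| + j%:R * rho * w j + lam * w j.

(** The probability that a red vertex of rank [j] ever turns blue: when its rank
is [i], the next change among the [i] reds between it and the blue front is a
capture rather than a death with probability [1 / (1 + i * rho)]. *)
Definition catch_prob rho j : R := \prod_(i < j) (1 + i.+1%:R * rho)^-1.

(** The surplus [lam] pays for the red vertices that a pair creates at rate
[lam] and that count for at most 1 each. *)
Definition subcritical D lam rho : Prop :=
  exists w, [/\ forall j, 0 <= w j, w 0%N = 0
              & forall j, drift D lam rho w j.+1 + lam <= 0].

(** The bound by [catch_prob] lets the number of blue vertices to come control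
the sum of the weights. *)
Definition at_least_critical D lam rho : Prop :=
  exists w C, [/\ w 0%N = 0, forall j, 0 < w j.+1,
                  forall j, 0 <= drift D lam rho w j.+1
                & forall j, w j <= C * catch_prob rho j].

(** Bounding the drift from below by the turnover makes it win against the
second order term of a function such as [h |-> c / (c + h)]. *)
Definition supercritical D lam rho : Prop :=
  exists w kappa J,
    [/\ 0 < kappa, w 0%N = 0 /\ 0 < w 1%N, forall j, 0 <= w j,
        forall j, (J < j)%N -> w j = 0
      & forall j, kappa * turnover D lam rho w j.+1 <= drift D lam rho w j.+1].

Lemma catch_prob_gt0 rho j : 0 < rho -> 0 < catch_prob rho j.
Proof.
by move=> rho0; apply: prodr_gt0 => i _; rewrite invr_gt0 ltr_wpDr ?mulr_ge0// ltW.
Qed.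

Lemma catch_probS rho j : 0 < rho ->
  (1 + j.+1%:R * rho) * catch_prob rho j.+1 = catch_prob rho j.
Proof.
move=> rho0; rewrite /catch_prob big_ord_recr /= mulrC -mulrA mulVf ?mulr1//.
by rewrite gt_eqF// ltr_wpDr ?mulr_ge0// ltW.
Qed.

Lemma catch_prob_le1 rho j : 0 < rho -> catch_prob rho j <= 1.
Proof.
move=> rho0; elim: j => [|j IH]; first by rewrite /catch_prob big_ord0.
rewrite /catch_prob big_ord_recr /=; apply: mulr_ile1 => //.
- by rewrite ltW// catch_prob_gt0.
- by rewrite invr_ge0 addr_ge0 ?mulr_ge0// ltW.
- by rewrite invf_le1 ?lerDl ?mulr_ge0 ?ltW// ltr_wpDr ?mulr_ge0// ltW.
Qed.

Lemma bounded_above_from (u : nat -> R) J C :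
  (forall j, (J <= j)%N -> u j <= C) -> exists C', forall j, u j <= C'.
Proof.
elim: J C => [|J IH] C uC; first by exists C => j; exact: uC.
apply: (IH (Num.max C (u J))) => j; rewrite leq_eqVlt => /orP[/eqP<-|/uC h].
  by rewrite le_max lexx orbT.
by rewrite le_max h.
Qed.

Lemma bounded_below_upto (u : nat -> R) J :
  (forall j, 0 < u j) -> exists2 e, 0 < e & forall j, (j <= J)%N -> e <= u j.
Proof.
move=> u0; elim: J => [|J [e e0 eu]].
  by exists (u 0%N) => // j; rewrite leqn0 => /eqP->.
exists (Num.min e (u J.+1)) => [|j]; first by rewrite lt_min e0 u0.
rewrite leq_eqVlt => /orP[/eqP->|/eu h]; first by rewrite ge_min lexx orbT.
by rewrite ge_min h.
Qed.

Lemma dominated_by_catch_prob rho w J : 0 < rho ->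
  (forall j, (J <= j)%N -> (1 + j.+1%:R * rho) * w j.+1 <= w j) ->
  exists C, forall j, w j <= C * catch_prob rho j.
Proof.
move=> rho0 wS.
have [|C wC] := @bounded_above_from (fun j => w j / catch_prob rho j) J
    (w J / catch_prob rho J).
  move=> j /subnK <-; elim: (j - J)%N => // k IH.
  apply: le_trans IH.
  have q0 : 0 < 1 + (k + J).+1%:R * rho :> R.
    by rewrite ltr_wpDr ?mulr_ge0// ltW.
  rewrite addSn -(@catch_probS rho (k + J))// ler_pdivrMr ?catch_prob_gt0//.
  rewrite invfM mulrA mulfVK ?gt_eqF ?catch_prob_gt0// ler_pdivlMr//.
  by rewrite mulrC wS// leq_addl.
by exists C => j; rewrite -ler_pdivrMr ?catch_prob_gt0.
Qed.

(** The recessive solution is built from its ratios of consecutive values, which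
are continued fractions. *)
Section Recessive.
Variables (D lam rho : R).
Hypotheses (D0 : 0 < D) (lam0 : 0 < lam) (rho0 : 0 < rho).
Let A j : R := 1 + lam + j%:R * rho.
Let c := lam * D.

Let c0 : 0 < c. Proof. exact: mulr_gt0. Qed.

(** Cutting off the continued fraction at [0] makes the approximations increase
with [n]. *)
Fixpoint convergent n j : R :=
  if n is n'.+1 then (A j - c * convergent n' j.+1)^-1 else 0.

Section Tail.
Variable J : nat.
Hypothesis JP : c + D <= J%:R * rho.

Let AJ j : (J <= j)%N -> 1 + lam + c + D <= A j.
Proof.
move=> Jj; rewrite /A -!addrA lerD2l lerD2l (le_trans JP)//.
by rewrite ler_wpM2r ?ler_nat// ltW.
Qed.

Let convergent_bound n j : (J <= j)%N ->
  [/\ 0 <= convergent n j, convergent n j <= 1 & D * convergent n j <= 1].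
Proof.
elim: n j => [|n IH] j Jj /=; first by rewrite mulr0 lexx ler01.
have [y0 y1 _] := IH _ (leqW Jj).
have h : 1 + D <= A j - c * convergent n j.+1.
  have : c * convergent n j.+1 <= c by rewrite ger_pMr.
  have := AJ Jj; have := lam0; lra.
have h0 : 0 < A j - c * convergent n j.+1 by have := D0; lra.
split; first by rewrite invr_ge0 ltW.
- by rewrite invf_le1//; have := D0; lra.
- by rewrite ler_pdivrMr// mul1r; have := D0; lra.
Qed.

Let convergent_den n j : (J <= j)%N -> 0 < A j - c * convergent n j.+1.
Proof.
move=> Jj; have [_ + _] := convergent_bound n (leqW Jj).
rewrite -(ler_pM2l c0) mulr1; have := AJ Jj; have := lam0; have := D0; lra.
Qed.

Let convergent_nd j : (J <= j)%N ->
  {homo convergent ^~ j : n m / (n <= m)%N >-> n <= m}.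
Proof.
move=> Jj; apply/nondecreasing_seqP => n; elim: n j Jj => [|n IH] j Jj.
  by have [] := convergent_bound 1 Jj.
have h1 := convergent_den n Jj; have h2 := convergent_den n.+1 Jj.
have h3 : convergent n j.+1 <= convergent n.+1 j.+1 := IH _ (leqW Jj).
change ((A j - c * convergent n j.+1)^-1 <= (A j - c * convergent n.+1 j.+1)^-1).
by rewrite lef_pV2 ?posrE// lerB// ler_pM2l.
Qed.

Let convergent_cvg j : (J <= j)%N -> cvgn (convergent ^~ j).
Proof.
move=> Jj; apply: nondecreasing_is_cvgn; first exact: convergent_nd.
by exists 1 => _ [n _ <-]; have [] := convergent_bound n Jj.
Qed.

Let ratio j : R := limn (convergent ^~ j).

Let ratio_bound j : (J <= j)%N ->
  [/\ 0 <= ratio j, ratio j <= 1 & D * ratio j <= 1].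
Proof.
move=> Jj; have cv := convergent_cvg Jj; split.
- by apply: limr_ge => //; near=> n; have [] := convergent_bound n Jj.
- by apply: limr_le => //; near=> n; have [] := convergent_bound n Jj.
- rewrite mulrC -ler_pdivlMr//; apply: limr_le => //; near=> n.
  by have [_ _] := convergent_bound n Jj; rewrite ler_pdivlMr// mulrC.
Unshelve. all: by end_near. Qed.

Let ratio_den j : (J <= j)%N -> 0 < A j - c * ratio j.+1.
Proof.
move=> Jj; have [_ + _] := ratio_bound (leqW Jj).
rewrite -(ler_pM2l c0) mulr1; have := AJ Jj; have := lam0; have := D0; lra.
Qed.

Let ratioE j : (J <= j)%N -> ratio j = (A j - c * ratio j.+1)^-1.
Proof.
move=> Jj; apply: cvg_lim => //; rewrite -(@cvg_shiftS R).
apply: cvgV; first by rewrite gt_eqF ?ratio_den.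
apply: cvgB; first exact: cvg_cst.
by apply: cvgMr; exact: convergent_cvg (leqW Jj).
Qed.

(** From [J] on the denominators of the continued fraction are so large that the
ratio is at most [1 / D], and then also at most the ratio of [catch_prob]. *)
Lemma recessive_tail : exists m,
  [/\ forall j, (J <= j)%N -> 0 < m j,
      forall j, (J <= j)%N -> drift D lam rho m j.+1 = 0
    & forall j, (J <= j)%N -> (1 + j.+1%:R * rho) * m j.+1 <= m j].
Proof.
pose m j := \prod_(i < j - J) ratio (J + i).+1.
have r0 j : (J <= j)%N -> 0 < ratio j.
  by move=> Jj; rewrite ratioE// invr_gt0 ratio_den.
have mS j : (J <= j)%N -> m j.+1 = m j * ratio j.+1.
  by move=> Jj; rewrite /m subSn// big_ord_recr /= subnKC.
have m0 j : (J <= j)%N -> 0 < m j.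
  by move=> Jj; apply: prodr_gt0 => i _; apply: r0; rewrite leqW// leq_addr.
exists m; split => // j Jj.
  rewrite /drift /= (mS j.+1) ?leqW// -/c -/(A j.+1).
  have -> : m j = (A j.+1 - c * ratio j.+2) * m j.+1.
    rewrite mS// (ratioE (leqW Jj)) mulrC divfK// gt_eqF// ratio_den// leqW//.
  by ring.
rewrite mS// mulrCA -[leRHS]mulr1 ler_pM2l ?m0// ratioE ?leqW//.
rewrite ler_pdivrMr ?ratio_den ?leqW// mul1r /A.
have [_ _ h] := ratio_bound (leqW (leqW Jj)).
have : lam * (D * ratio j.+2) <= lam * 1 by rewrite ler_pM2l.
by rewrite mulrA -/c; lra.
Qed.

End Tail.

(** The recurrence yields each value from the two after it. *)
Lemma extend_backward m J :
  (forall j, (J <= j)%N -> drift D lam rho m j.+1 = 0) ->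
  exists2 m', (forall j, (J <= j)%N -> m' j = m j)
            & forall j, drift D lam rho m' j.+1 = 0.
Proof.
elim: J m => [|J IH] m mE; first by exists m => // j; exact: mE.
pose m1 j := if j == J then A J.+1 * m J.+1 - c * m J.+2 else m j.
have m1E j : (J < j)%N -> m1 j = m j by rewrite /m1; case: ltngtP.
have [|m' m'E m'd] := IH m1.
  move=> j; rewrite leq_eqVlt => /orP[/eqP<-|Jj].
    have m1J : m1 J = A J.+1 * m J.+1 - c * m J.+2 by rewrite /m1 eqxx.
    by rewrite /drift /= m1J !m1E// -/c -/(A J.+1); ring.
  by rewrite /drift /= !m1E ?leqW//; exact: mE.
by exists m' => // j Jj; rewrite m'E ?m1E// ltnW.
Qed.

Lemma recessive : exists m J,
  [/\ forall j, (J <= j)%N -> 0 < m j,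
      forall j, drift D lam rho m j.+1 = 0
    & forall j, (J <= j)%N -> (1 + j.+1%:R * rho) * m j.+1 <= m j].
Proof.
have [J JP] : exists J, c + D <= J%:R * rho.
  exists (Num.truncn ((c + D) / rho)).+1; rewrite -ler_pdivrMr//.
  by rewrite ltW// truncnS_gt.
have [m0 [pos dr dec]] := recessive_tail JP.
have [m mE dm] := extend_backward dr.
exists m, J; split => // j Jj; first by rewrite mE ?pos.
by rewrite !mE ?leqW// dec.
Qed.

End Recessive.
End Recurrence.

Section Dichotomy.
Context {R : realType}.
Implicit Types (D lam rho C : R) (w m : nat -> R) (j J : nat).

Lemma last_nonpositive m J : (forall j, (J <= j)%N -> 0 < m j) ->
  (forall j, 0 < m j) \/
  (exists2 i, m i <= 0 & forall j, (i < j)%N -> 0 < m j).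
Proof.
elim: J => [|J IH] mJ; first by left => j; exact: mJ.
have [mJ0|mJ0] := leP (m J) 0; first by right; exists J.
by apply: IH => j; rewrite leq_eqVlt => /orP[/eqP<-|/mJ].
Qed.

(** Replacing [m i <= 0] by 0 can only increase the drift at the next index, and
so does the shift of indices by [i], because the death term [j * rho] grows with
[j]. *)
Lemma at_least_critical_of_shift D lam rho m i J : 0 < rho ->
  (forall j, drift D lam rho m j.+1 = 0) -> m i <= 0 ->
  (forall j, (i < j)%N -> 0 < m j) ->
  (forall j, (J <= j)%N -> (1 + j.+1%:R * rho) * m j.+1 <= m j) ->
  at_least_critical D lam rho.
Proof.
move=> rho0 dm mi m0 mdec.
pose w j := if j is 0 then 0 else m (i + j)%N.
have [C wC] : exists C, forall j, w j <= C * catch_prob rho j.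
  apply: (@dominated_by_catch_prob _ _ _ J.+1) => // -[//|j] Jj.
  rewrite /w (addnS i j.+1); apply: le_trans (mdec (i + j.+1)%N _).
    rewrite ler_wpM2r//; first by rewrite ltW// m0// ltnS leq_addr.
    by rewrite lerD2l ler_wpM2r ?(ltW rho0)// ler_nat ltnS leq_addl.
  by rewrite (leq_trans (ltnW Jj))// leq_addl.
exists w, C; split => // j.
  by rewrite /w m0// addnS ltnS leq_addr.
have wj : m (i + j)%N <= w j by case: j => [|j]; rewrite ?addn0.
have m1 : 0 <= m (i + j).+1 by rewrite ltW// m0// ltnS leq_addr.
have : j.+1%:R * rho * m (i + j).+1 <= (i + j).+1%:R * rho * m (i + j).+1.
  by rewrite ler_wpM2r// ler_wpM2r ?(ltW rho0)// ler_nat ltnS leq_addl.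
have := dm (i + j)%N; rewrite /drift /= -/(w j) !addnS; lra.
Qed.

(** A solution that is positive down to index 0 can be made strictly
superharmonic by multiplying it with an increasing bounded sequence that
vanishes at 0, and this leaves room for a smaller death rate. *)
Section Slack.
Variables (D lam rho : R) (m : nat -> R).
Hypotheses (D0 : 0 < D) (lam0 : 0 < lam) (rho0 : 0 < rho).
Hypotheses (m0 : forall j, 0 < m j) (dm : forall j, drift D lam rho m j.+1 = 0).
Let c := lam * D.
Let c0 : 0 < c. Proof. exact: mulr_gt0. Qed.

(** The first argument of the minimum lets the gain from step [j] outweigh twice
the loss from step [j.+1]; the second one keeps the sum bounded. *)
Fixpoint increment j : R :=
  if j is j'.+1 then
    Num.min (m j' / (c * m j'.+2) * increment j' / 2) (2^-1 ^+ j)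
  else 1.

Let increment_gt0 j : 0 < increment j.
Proof.
elim: j => //= j IH; rewrite lt_min exprn_gt0// andbT.
by rewrite divr_gt0// mulr_gt0// divr_gt0// mulr_gt0.
Qed.

Definition stretched j : R := m j * \sum_(i < j) increment i.

Lemma stretched_ge0 j : 0 <= stretched j.
Proof.
by apply: mulr_ge0; [exact: ltW | apply: sumr_ge0 => i _; exact: ltW].
Qed.

Lemma stretched_le j : stretched j <= 2 * m j.
Proof.
rewrite /stretched mulrC ler_pM2r//.
have : \sum_(i < j) increment i <= \sum_(i < j) (2^-1 ^+ i : R).
  by apply: ler_sum => -[[|i] /= _] _; rewrite ?expr0// ge_min lexx orbT.
move=> /le_trans; apply.
have : (\sum_(i < j) 2^-1 ^+ i) * (1 - 2^-1) = 1 - 2^-1 ^+ j :> R.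
  elim: j => [|j IH]; first by rewrite big_ord0 expr0 mul0r subrr.
  by rewrite big_ord_recr /= mulrDl IH exprS; field.
have : 0 < 2^-1 ^+ j :> R by rewrite exprn_gt0.
lra.
Qed.

(** Multiplying [m] by partial sums of [increment] changes its drift, which is 0,
by the loss from the next increment minus the gain from the last one. *)
Lemma stretched_drift j :
  drift D lam rho stretched j.+1 <= - (m j * increment j / 2).
Proof.
rewrite /drift /stretched -/c !big_ord_recr /=.
set S := \sum_(i < j) _; set p := _ / 2.
have hp : p * (c * m j.+2) = m j * increment j / 2.
  by rewrite /p; field; rewrite !gt_eqF// m0.
have : c * m j.+2 * Num.min p (2^-1 ^+ j.+1) <= m j * increment j / 2.
  by rewrite -hp mulrC ler_pM2r ?mulr_gt0// ge_min lexx.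
have := dm j; rewrite /drift -/c /=.
set x := Num.min _ _; set e := increment j => h1 h2.
have -> : c * (m j.+2 * (S + e + x)) + m j * S -
   (1 + lam + j.+1%:R * rho) * (m j.+1 * (S + e)) =
   c * m j.+2 * x - m j * e + (S + e) * (c * m j.+2 + m j -
   (1 + lam + j.+1%:R * rho) * m j.+1) by ring.
by rewrite h1 mulr0 addr0; lra.
Qed.

Lemma drift_combine K (w t : nat -> R) rho' j :
  drift D lam rho' (fun j => K * w j + t j) j =
  K * (drift D lam rho w j + j%:R * (rho - rho') * w j) + drift D lam rho' t j.
Proof. by rewrite /drift; ring. Qed.

(** A large multiple of [stretched] takes care of the surplus [lam] up to an index
[J]; beyond [J], where deaths dominate everything else, the constant weight 1
does so. Both have slack, hence a small change of [rho] does no harm. *)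
Lemma subcritical_near B : (forall j, m j <= B) ->
  exists2 e, 0 < e & forall rho', rho - e < rho' <= rho -> subcritical D lam rho'.
Proof.
move=> mB; pose b : R := 2 * B; have b0 : 0 < b.
  by rewrite mulr_gt0//; exact: lt_le_trans (mB 0%N).
have wb j : stretched j <= b.
  by apply: le_trans (stretched_le j) _; rewrite ler_pM2l.
(* A quarter of the death rate at [J] already exceeds the branching rate [c] that
   acts on the constant weight. *)
have [J J0 Jc] : exists2 J, 0 < J%:R :> R & 4 * c <= J%:R * rho.
  exists (Num.truncn (4 * c / rho)).+1; first by rewrite ltr0n.
  by rewrite -ler_pdivrMr// ltW// truncnS_gt.
have [|s s0 sP] := @bounded_below_upto _ (fun j => m j * increment j / 2) J.
  by move=> j; rewrite divr_gt0// mulr_gt0.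
pose K := 2 * (c + lam) / s.
have K0 : 0 < K by rewrite divr_gt0// mulr_gt0// addr_gt0.
(* The second bound leaves half of the slack [s] up to [J]; the first and the
   third one leave a quarter of the death rate beyond [J]. *)
pose e := Num.min (rho / 2) (Num.min (s / (2 * J%:R * b)) (rho / (4 * K * b))).
have e0 : 0 < e.
  rewrite /e !lt_min; apply/and3P; split; apply: divr_gt0 => //.
    by rewrite mulr_gt0// mulr_gt0.
  by rewrite mulr_gt0// mulr_gt0.
exists e => //.
move=> rho' /andP[rho'l rho'r].
have [e1 e2 e3] : [/\ e <= rho / 2, e * (2 * J%:R * b) <= s
                    & e * (4 * K * b) <= rho].
  split; first by rewrite ge_min lexx.
    rewrite -ler_pdivlMr; last by rewrite mulr_gt0// mulr_gt0.
    by rewrite /e !ge_min lexx orbT.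
  rewrite -ler_pdivlMr; last by rewrite mulr_gt0// mulr_gt0.
  by rewrite /e !ge_min lexx !orbT.
pose t j : R := (J < j)%N%:R.
exists (fun j => K * stretched j + t j); split => [j||j].
- by rewrite addr_ge0// mulr_ge0 ?stretched_ge0// ltW.
- by rewrite /stretched big_ord0 !mulr0 add0r /t.
rewrite drift_combine.
have sw : (rho - rho') * stretched j.+1 <= e * b.
  by rewrite ler_pM ?stretched_ge0 ?wb ?subr_ge0//; lra.
have dw := stretched_drift j.
have jn : 0 <= j.+1%:R :> R by [].
have hh : K * (drift D lam rho stretched j.+1 +
    j.+1%:R * (rho - rho') * stretched j.+1) <=
    K * (- (m j * increment j / 2) + j.+1%:R * (e * b)).
  by rewrite ler_pM2l// lerD// -mulrA ler_wpM2l.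
have [jJ|Jj] := leqP j.+1 J.
  have dt : drift D lam rho' t j.+1 <= c.
    have tz i : (i <= J)%N -> t i = 0 by rewrite /t leqNgt; case: ltnP.
    rewrite /drift /= (tz j.+1)// (tz j) 1?ltnW// mulr0 subr0 addr0 -/c /t.
    by case: ltnP => _; rewrite ?mulr1 ?mulr0// ltW.
  have jJR : j.+1%:R * (e * b) <= J%:R * (e * b).
    by rewrite ler_wpM2r ?ler_nat// mulr_ge0 ?(ltW b0)// ltW.
  have : K * (- (m j * increment j / 2) + j.+1%:R * (e * b)) <= K * (- (s / 2)).
    rewrite ler_pM2l//; have := sP _ (ltnW jJ); lra.
  have : K * (- (s / 2)) = - (c + lam) by rewrite /K; field; rewrite gt_eqF.
  lra.
have dt : drift D lam rho' t j.+1 <= c + 1 - (1 + lam + j.+1%:R * rho').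
  rewrite /drift /t /= (leqW Jj) Jj /= mulr1 mulr1 -/c lerD2r lerD2l.
  by case: ltnP.
have : K * (- (m j * increment j / 2) + j.+1%:R * (e * b)) <= j.+1%:R * (rho / 4).
  apply: (@le_trans _ _ (K * (j.+1%:R * (e * b)))).
    rewrite ler_pM2l// gerDr oppr_le0 ltW// divr_gt0// mulr_gt0//.
  rewrite mulrCA ler_wpM2l//; lra.
have : J%:R * rho <= j.+1%:R * rho by rewrite ler_pM2r// ler_nat ltnW.
have : j.+1%:R * (rho / 2) <= j.+1%:R * rho' by rewrite ler_wpM2l//; lra.
lra.
Qed.

End Slack.

Lemma subcritical_or_at_least_critical D lam rho : 0 < D -> 0 < lam -> 0 < rho ->
  (exists2 e, 0 < e &
     forall rho', rho - e < rho' <= rho -> subcritical D lam rho') \/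
  at_least_critical D lam rho.
Proof.
move=> D0 lam0 rho0; have [m [J [mJ dm mdec]]] := recessive D0 lam0 rho0.
have [mpos|[i mi mipos]] := last_nonpositive mJ; [left|right].
  have [C mC] := dominated_by_catch_prob rho0 mdec.
  apply: (subcritical_near D0 lam0 rho0 mpos dm (B := C)) => j.
  apply: le_trans (mC j) _.
  have C0 : 0 <= C.
    have := lt_le_trans (mpos 0%N) (mC 0%N).
    by rewrite pmulr_lgt0 ?catch_prob_gt0// => /ltW.
  by rewrite -[leRHS]mulr1 ler_wpM2l// catch_prob_le1.
exact: at_least_critical_of_shift dm mi mipos mdec.
Qed.

(** A minimum over finitely many indices gives the factor [kappa]: at the first
index after the support of [w], drift and turnover coincide, and further on both
vanish. *)
Lemma supercritical_of_drift_gt0 D lam rho w J :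
  w 0%N = 0 -> 0 < lam -> 0 < D -> 0 < rho ->
  (forall j, (j < J.+1)%N -> 0 < w j.+1) ->
  (forall j, (J.+1 < j)%N -> w j = 0) ->
  (forall j, (j < J.+1)%N -> 0 < drift D lam rho w j.+1) ->
  supercritical D lam rho.
Proof.
move=> w0 lam0 D0 rho0 wpos wz dpos.
have wge0 j : 0 <= w j.
  case: j => [|j]; first by rewrite w0.
  by have [/wpos/ltW//|h] := ltnP j J.+1; rewrite wz.
have [k k0 kP] : exists2 k, 0 < k & forall j, (j <= J)%N ->
    k <= drift D lam rho w (minn j J).+1 / (1 + turnover D lam rho w (minn j J).+1).
  apply: (@bounded_below_upto _ (fun j => drift D lam rho w (minn j J).+1 /
   (1 + turnover D lam rho w (minn j J).+1))) => j; rewrite divr_gt0//.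
    by apply: dpos; rewrite ltnS geq_minr.
  rewrite /turnover; move: (minn j J).+1 => i.
  rewrite ltr_wpDr//; do ?[apply: addr_ge0 => //]; do ?[apply: mulr_ge0 => //];
    exact: ltW.
exists w, (Num.min k 1), J.+1; split => //.
- by rewrite lt_min k0 /=.
- by split=> //; exact: wpos.
move=> j; have [jJ|Jj] := leqP j J.
  have V0 : 0 <= turnover D lam rho w j.+1.
    rewrite /turnover; do ?[apply: addr_ge0 => //]; do ?[apply: mulr_ge0 => //];
    exact: ltW.
  have := kP _ jJ; rewrite (minn_idPl jJ) ler_pdivlMr; last by rewrite ltr_wpDr.
  apply: le_trans.
  apply: (@le_trans _ _ (k * turnover D lam rho w j.+1)).
    by rewrite ler_wpM2r// ge_min lexx.
  by rewrite ler_pM2l// lerDr.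
have wj : w j.+1 = 0 by rewrite wz.
have wj1 : w j.+2 = 0 by rewrite wz// ltnW.
rewrite /turnover /drift /= wj wj1 !mulr0 !subr0 !add0r !addr0 ger0_norm//.
by rewrite ler_piMl// ge_min lexx orbT.
Qed.

(** Lowering the death rate from [rho] to [rho'] adds [j * (rho - rho') * w j] to
the drift. At a large index [J] after which the weight does not increase, this
also pays for dropping the weights beyond [J]. *)
Lemma supercritical_of_lower_death D lam rho rho' : 0 < D -> 0 < lam ->
  0 < rho' < rho -> at_least_critical D lam rho -> supercritical D lam rho'.
Proof.
move=> D0 lam0 /andP[rho'0 rhorho] [w [C [w0 wpos dw wC]]].
have rho0 : 0 < rho by exact: lt_trans rhorho.
have [J0 J0P] : exists J0, forall j, (J0 <= j)%N -> lam * D < j%:R * (rho - rho').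
  exists (Num.truncn (lam * D / (rho - rho'))).+1 => j Jj.
  rewrite -ltr_pdivrMr ?subr_gt0//; apply: lt_le_trans (truncnS_gt _) _.
  by rewrite ler_nat.
(* Otherwise [w] would increase from some index on, although [catch_prob] tends
   to 0. *)
have [J J0J wJ] : exists2 J, (J0 <= J)%N & w J.+2 <= w J.+1.
  apply: contrapT => H.
  have winc j : (J0 <= j)%N -> w J0.+1 <= w j.+1.
    move=> /subnK <-; elim: (j - J0)%N => // k IH; apply: le_trans IH _.
    rewrite addSn leNgt; apply/negP => h; apply: H; exists (k + J0)%N.
      by rewrite leq_addl.
    exact: ltW.
  have wp := wpos J0.
  have C0 : 0 < C.
    have := lt_le_trans wp (wC J0.+1).
    by rewrite pmulr_lgt0 ?catch_prob_gt0.
  pose n := (J0 + (Num.truncn (C / (rho * w J0.+1))).+1)%N.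
  have := le_trans (winc n (leq_addr _ _)) (wC n.+1).
  apply/negP; rewrite -ltNge.
  have q0 : 0 < 1 + n.+1%:R * rho by rewrite ltr_pwDl// mulr_ge0// ltW.
  rewrite -(ltr_pM2l q0) mulrCA catch_probS//.
  apply: (@le_lt_trans _ _ (C * 1)).
    by rewrite ler_pM2l// catch_prob_le1.
  rewrite mulr1 mulrDl; apply: ltr_pwDl; first by rewrite mul1r.
  rewrite -mulrA -ler_pdivrMr ?mulr_gt0// ltW//.
  apply: lt_le_trans (truncnS_gt _) _.
  by rewrite ler_nat leqW// /n leq_addl.
pose v j := if (j <= J.+1)%N then w j else 0.
have vE j : (j <= J.+1)%N -> v j = w j by rewrite /v => ->.
apply: (@supercritical_of_drift_gt0 _ _ _ v J) => // [j jJ|j jJ|j jJ].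
- by rewrite vE.
- by rewrite /v leqNgt jJ.
have drd : drift D lam rho' w j.+1 =
    drift D lam rho w j.+1 + j.+1%:R * (rho - rho') * w j.+1.
  by rewrite /drift; ring.
have [jJ'|Jj] := ltnP j J.
  have -> : drift D lam rho' v j.+1 = drift D lam rho' w j.+1.
    by rewrite /drift /= !vE// ltnW.
  rewrite drd ltr_wpDl//; by rewrite !mulr_gt0 ?ltr0Sn ?subr_gt0.
have -> : j = J by apply/eqP; rewrite eqn_leq Jj andbT -ltnS.
have := dw J; rewrite /drift /= (vE J)// (vE J.+1)// /v ltnn mulr0 add0r.
have : lam * D * w J.+2 <= lam * D * w J.+1 by rewrite ler_pM2l// mulr_gt0.
have : lam * D * w J.+1 < J.+1%:R * (rho - rho') * w J.+1.
  by rewrite ltr_pM2r// J0P// leqW.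
lra.
Qed.

(** Without deaths the recurrence has constant coefficients, and its solutions
oscillate if [(1 + lam) ^+ 2 < 4 * (lam * D)]. The sequence [j * (J + 1 - j)],
whose second difference is [- 2], replaces the first arch of such an
oscillation, up to a geometric factor. *)
Lemma supercritical_small_death D lam : 1 <= D -> 0 < lam ->
  (1 + lam) ^+ 2 < 4 * (lam * D) ->
  exists2 r, 0 < r & forall rho, 0 < rho < r -> supercritical D lam rho.
Proof.
move=> D1 lam0 H; have D0 : 0 < D by exact: lt_le_trans D1.
have c0 : 0 < lam * D by rewrite mulr_gt0.
pose q := Num.sqrt (lam * D).
have q0 : 0 < q by rewrite sqrtr_gt0.
have qq : q * q = lam * D by rewrite -expr2 sqr_sqrtr// ltW.
have Hq : 1 + lam < 2 * q.
  rewrite -(@ltr_pXn2r _ 2)// ?nnegrE ?addr_ge0 ?mulr_ge0 ?(ltW lam0) ?(ltW q0)//.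
  by rewrite exprMn (expr2 q) qq; lra.
pose g := 2 * q - (1 + lam).
have g0 : 0 < g by rewrite subr_gt0.
have [J' Jg] : exists J', 4 * q < J'.+1%:R * g.
  by exists (Num.truncn (4 * q / g)); rewrite -ltr_pdivrMr// truncnS_gt.
set J := J'.+1 in Jg.
have J0 : 0 < J%:R :> R by rewrite ltr0n.
exists (g / (2 * J%:R)); first by rewrite divr_gt0// mulr_gt0.
move=> rho /andP[rho0]; rewrite ltr_pdivlMr ?mulr_gt0// => rhog.
pose s j : R := j%:R * (J%:R + 1 - j%:R).
pose w j := if (j <= J)%N then (q^-1) ^+ j * s j else 0.
have wE j : (j <= J.+1)%N -> w j = (q^-1) ^+ j * s j.
  rewrite /w leq_eqVlt => /orP[/eqP->|]; last by rewrite ltnS => ->.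
  by rewrite ltnn /s -natr1 subrr !mulr0.
have sJ j : (j < J)%N -> J%:R <= s j.+1.
  move=> jJ; rewrite /s -natr1.
  have : j%:R + 1 <= J%:R :> R by rewrite natr1 ler_nat.
  have : 0 <= j%:R :> R by [].
  set x : R := j%:R; set y : R := J%:R => x0 xy.
  rewrite -subr_ge0.
  have -> : (x + 1) * (y + 1 - (x + 1)) - y = x * (y - (x + 1)) by ring.
  by rewrite mulr_ge0// subr_ge0.
have s0 j : (j < J)%N -> 0 < s j.+1 by move=> /sJ; exact: lt_le_trans.
have qi0 : 0 < q^-1 by rewrite invr_gt0.
apply: (@supercritical_of_drift_gt0 _ _ _ w J') => // [|j jJ|j jJ|j jJ].
- by rewrite wE// /s mul0r mulr0.
- by rewrite wE 1?ltnW// mulr_gt0 ?exprn_gt0 ?s0.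
- by rewrite /w leqNgt jJ.
have jJ1 : (j.+1 <= J.+1)%N by exact: leqW.
rewrite /drift /= (wE j.+2)// (wE j.+1)// (wE j) 1?ltnW//.
have -> : lam * D * (q^-1 ^+ j.+2 * s j.+2) + q^-1 ^+ j * s j -
  (1 + lam + j.+1%:R * rho) * (q^-1 ^+ j.+1 * s j.+1) =
  q^-1 ^+ j.+1 * (q * (s j.+2 + s j) - (1 + lam + j.+1%:R * rho) * s j.+1).
  rewrite !exprS -qq; field; exact: lt0r_neq0.
rewrite mulr_gt0 ?exprn_gt0// subr_gt0.
have -> : s j.+2 + s j = 2 * s j.+1 - 2 by rewrite /s -!natr1; ring.
have jr : j.+1%:R * rho <= J%:R * rho by rewrite ler_pM2r// ler_nat.
have h1 : (1 + lam + j.+1%:R * rho) * s j.+1 <= (2 * q - g / 2) * s j.+1.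
  by rewrite ler_pM2r ?s0// -/g; rewrite /g in rhog *; lra.
apply: le_lt_trans h1 _.
have := sJ _ jJ; rewrite -(ler_pM2r g0) => h2.
lra.
Qed.

(** The two bounds are the roots of [(1 + lam) ^+ 2 - 4 * (lam * d%:R)]. *)
Lemma Lambda_interval d (lam : R) : (2 <= d)%N ->
  lambda_c_minus d < lam < lambda_c_plus d ->
  0 < lam /\ (1 + lam) ^+ 2 < 4 * (lam * d%:R).
Proof.
move=> d2; rewrite /lambda_c_minus /lambda_c_plus.
have dR : 2 <= d%:R :> R by rewrite ler_nat.
set D : R := d%:R in dR *.
have D20 : 0 <= D ^+ 2 - D by rewrite subr_ge0 expr2 ler_peMl; lra.
have := sqr_sqrtr D20; have := sqrtr_ge0 (D ^+ 2 - D).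
set q := Num.sqrt _ => q0 qq /andP[l1 l2].
have H : 0 < (2 * q - (lam - (2 * D - 1))) * (2 * q + (lam - (2 * D - 1))).
  by rewrite mulr_gt0//; lra.
have H2 : (1 + lam) ^+ 2 < 4 * (lam * D).
  rewrite -subr_gt0; apply: lt_le_trans H _; rewrite le_eqVlt; apply/orP; left.
  have -> : (2 * q - (lam - (2 * D - 1))) * (2 * q + (lam - (2 * D - 1)))
   = 4 * q ^+ 2 - (lam - (2 * D - 1)) ^+ 2 by ring.
  by rewrite qq; apply/eqP; ring.
split=> //; have : 0 <= (1 + lam) ^+ 2 by exact: sqr_ge0.
move=> /le_lt_trans/(_ H2); rewrite pmulr_rgt0// pmulr_lgt0//; lra.
Qed.

End Dichotomy.

(** * Ranks and the generator *)

Lemma color_eqE :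
  (((red == white) = false) * ((red == blue) = false) * ((red == dead) = false) *
   ((blue == white) = false) * ((blue == red) = false) * ((blue == dead) = false) *
   ((dead == white) = false) * ((dead == red) = false) * ((dead == blue) = false) *
   ((white == red) = false) * ((white == blue) = false) * ((white == dead) = false) *
   ((white == white) = true) * ((red == red) = true) * ((blue == blue) = true) *
   ((dead == dead) = true))%type.
Proof. by do ![split]; apply/eqP. Qed.

Section Tree.
Context {R : realType} {d : nat}.
Variables (lam rho : R).
Local Notation state := (vertex d -> color).
Local Notation word := (seq 'I_d).
Implicit Types (x y : state) (s t u : word) (M N k : nat).

Fixpoint words M : seq word :=
  if M is M'.+1 then [::] :: [seq i :: s | i <- enum 'I_d, s <- words M']
  else [:: [::]].

Lemma mem_words M s : (s \in words M) = (size s <= M)%N.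
Proof.
elim: M s => [|M IH] [|i s] //; rewrite /= inE /=.
apply/allpairsP/idP => [[[j t] /= [_ tM [_ ->]]]|sM]; first by rewrite ltnS -IH.
by exists (i, s); rewrite mem_enum IH.
Qed.

Lemma words_uniq M : uniq (words M).
Proof.
elim: M => //= M IH; rewrite allpairs_uniq ?enum_uniq// ?andbT.
  by apply/allpairsP => -[[j t] /= []].
by move=> [i s] [j t] _ _ /= [-> ->].
Qed.

Lemma big_words M (F : word -> R) :
  \sum_(s <- words M.+1) F s =
  F [::] + \sum_(i < d) \sum_(s <- words M) F (i :: s).
Proof. by rewrite /= big_cons big_allpairs_dep big_enum. Qed.

Lemma words_widen M N (F : word -> R) : (M <= N)%N ->
  (forall s, (M < size s)%N -> F s = 0) ->
  \sum_(s <- words N) F s = \sum_(s <- words M) F s.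
Proof.
move=> MN F0; rewrite [LHS](bigID (mem (words M))) /=.
rewrite [X in _ + X]big1 ?addr0; last by move=> s; rewrite mem_words -ltnNge => /F0.
rewrite -big_filter; apply: perm_big; apply: uniq_perm.
- exact/filter_uniq/words_uniq.
- exact: words_uniq.
by move=> s; rewrite mem_filter !mem_words; case: leqP => //= /leq_trans ->.
Qed.

Lemma sum_words_le M N (F : word -> R) : (M <= N)%N -> (forall s, 0 <= F s) ->
  \sum_(s <- words M) F s <= \sum_(s <- words N) F s.
Proof.
move=> MN F0; pose G s := if (size s <= M)%N then F s else 0.
have -> : \sum_(s <- words M) F s = \sum_(s <- words M) G s.
  by apply: eq_big_seq => s; rewrite mem_words /G => ->.
rewrite -(words_widen MN); last by move=> s; rewrite ltnNge /G => /negPf ->.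
by apply: ler_sum => s _; rewrite /G; case: ifP.
Qed.

Definition par s : vertex d := if s is _ :: s' then Some s' else None.

(** In a [reachable] state only the parent of a vertex can make it red or blue,
so that these are the rates of the process, see [ced_rate_recolor]. *)
Definition rate x s (c : color) : R :=
  match c with
  | white => 0
  | red => lam * ((x (Some s) == white) && (x (par s) == red))%:R
  | blue => ((x (Some s) == red) && (x (par s) == blue))%:R
  | dead => rho * (x (Some s) == red)%:R
  end.

Definition move_sum (F : state -> R) x s : R :=
  rate x s red * F (recolor x (Some s) red) +
  rate x s blue * F (recolor x (Some s) blue) +
  rate x s dead * F (recolor x (Some s) dead).

(** Applied to the increments of a function this is its generator, provided that
no vertex deeper than [N] can change its colour. *)
Definition rate_sum N (F : state -> R) x : R := \sum_(s <- words N) move_sum F x s.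

(** The extra vertex above the root is taken to be blue, as it always is. *)
Fixpoint rank x s : option nat :=
  match x (Some s) with
  | blue => Some 0%N
  | red => if s is _ :: s' then omap S (rank x s') else Some 1%N
  | _ => None
  end.

(** An invariant of the jump chain after [k] jumps. The bounds on depth and number
of the non-white vertices make the sums over [words] complete and the total rate
at most linear in [k]. *)
Record reachable k x : Prop := Reachable {
  reach_extra : x None = blue;
  reach_root : x (Some [::]) <> white;
  reach_conn : forall s, x (Some s) <> white -> x (par s) <> white;
  reach_blue : forall s, x (Some s) = blue -> x (par s) = blue;
  reach_size : forall s, (k < size s)%N -> x (Some s) = white;
  reach_count : forall M,
    \sum_(s <- words M) (x (Some s) != white)%:R <= k.+1%:R :> R }.

Lemma recolor_eq x (v : vertex d) c : recolor x v c v = c.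
Proof. by rewrite /recolor eqxx. Qed.

Lemma recolor_neq x (v u : vertex d) c : u != v -> recolor x v c u = x u.
Proof. by rewrite /recolor => /negPf ->. Qed.

Lemma par_neq s : par s != Some s.
Proof.
case: s => //= i s; apply/eqP => -[/(congr1 size)/= /eqP].
by rewrite eqn_leq ltnn andbF.
Qed.

Lemma rank_recolor_out x u c s :
  (forall p, s <> p ++ u) -> rank (recolor x (Some u) c) s = rank x s.
Proof.
elim: s => [|i s IH] sp /=.
  by rewrite recolor_neq//; apply/eqP => -[e]; apply: (sp [::]).
rewrite recolor_neq; last by apply/eqP => -[e]; apply: (sp [::]).
by rewrite IH// => p e; apply: (sp (i :: p)); rewrite e.
Qed.

Lemma rank_recolor_child x i s c :
  rank (recolor x (Some (i :: s)) c) s = rank x s.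
Proof.
apply: rank_recolor_out => p /(congr1 size)/=; rewrite size_cat /= => /eqP.
by rewrite addnS -addSn -[X in (X == _)]add0n eqn_add2r.
Qed.

Lemma rank_blue x s : x (Some s) = blue -> rank x s = Some 0%N.
Proof. by case: s => [|i s] /= ->. Qed.

Lemma rank_white x s : x (Some s) = white -> rank x s = None.
Proof. by case: s => [|i s] /= ->. Qed.

Lemma rank_dead x s : x (Some s) = dead -> rank x s = None.
Proof. by case: s => [|i s] /= ->. Qed.

Lemma rank0 x s : rank x s = Some 0%N -> x (Some s) = blue.
Proof. by case: s => [|i s] /=; case: (x _) => //; case: rank. Qed.

Lemma rankS x s j : rank x s = Some j.+1 -> x (Some s) = red.
Proof. by case: s => [|i s] /=; case: (x _). Qed.

Lemma move_sum_eq0 F x s : (forall c, rate x s c != 0 ->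
  F (recolor x (Some s) c) = 0) -> move_sum F x s = 0.
Proof.
move=> H; rewrite /move_sum.
have h c : rate x s c * F (recolor x (Some s) c) = 0.
  by have [->|/H ->] := eqVneq (rate x s c) 0; rewrite ?mul0r ?mulr0.
by rewrite !h !addr0.
Qed.

Lemma eq_move_sum F G x s : (forall c, rate x s c != 0 ->
  F (recolor x (Some s) c) = G (recolor x (Some s) c)) ->
  move_sum F x s = move_sum G x s.
Proof.
move=> H; rewrite /move_sum.
have h c : rate x s c * F (recolor x (Some s) c) =
           rate x s c * G (recolor x (Some s) c).
  by have [->|/H ->] := eqVneq (rate x s c) 0; rewrite ?mul0r.
by rewrite !h.
Qed.

Lemma rate_sumD1 N F x s : (size s <= N)%N ->
  rate_sum N F x = move_sum F x s +
     \sum_(u <- words N | u != s) move_sum F x u.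
Proof. by move=> sN; rewrite /rate_sum (bigD1_seq s) ?mem_words ?words_uniq. Qed.

(** For functions that differ only in their reaction to the move at [s]. *)
Lemma rate_sum_local N F G x s : (size s <= N)%N ->
  (forall u c, u != s -> rate x u c != 0 ->
     F (recolor x (Some u) c) = G (recolor x (Some u) c)) ->
  rate_sum N F x = rate_sum N G x + move_sum F x s - move_sum G x s.
Proof.
move=> sN FG; rewrite !(rate_sumD1 _ _ sN).
rewrite (eq_bigr (fun u => move_sum G x u)); first by ring.
by move=> u us; apply: eq_move_sum => c; apply: FG.
Qed.

Lemma rate_sum_eq0 N F x :
  (forall u c, rate x u c != 0 -> F (recolor x (Some u) c) = 0) ->
  rate_sum N F x = 0.
Proof. by move=> F0; apply: big1 => u _; apply: move_sum_eq0 => c; apply: F0. Qed.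

Lemma Some_neq s u : u != s -> Some s != Some u :> vertex d.
Proof. by rewrite eq_sym => us; apply: contra us => /eqP[->]. Qed.

(** The rank of a red vertex changes in two ways: one of the [j] reds on the path
up to the blue front dies, or the topmost of them turns blue. In the induction
along the path the rank of a vertex is the successor of the rank of its parent,
which is why [g] is arbitrary. *)
Lemma rate_sum_rank N k x s (g : option nat -> R) : reachable k x ->
  (size s <= N)%N -> x (Some s) <> white -> g (rank x s) = 0 ->
  rate_sum N (fun y => g (rank y s)) x =
  if rank x s is Some j.+1 then g (Some j) + j.+1%:R * rho * g None else 0.
Proof.
move=> rx; elim: s g => [|i s IH] g sN xs gx.
  rewrite (@rate_sum_local _ _ (fun=> 0) _ [::])//; last first.
    move=> u c us _; rewrite -[RHS]gx /= recolor_neq// Some_neq//.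
  rewrite [rate_sum _ _ _]rate_sum_eq0// [X in _ - X]move_sum_eq0// subr0 add0r.
  rewrite /move_sum /rate !(@rank_blue (recolor _ _ blue)) ?recolor_eq//.
  rewrite !(@rank_dead (recolor _ _ dead)) ?recolor_eq//= (reach_extra rx) eqxx.
  by case: (x (Some [::])) xs gx => //= _ gx; rewrite ?color_eqE /=; ring.
have sN' : (size s <= N)%N by apply: ltnW.
case xisE : (x (Some (i :: s))) xs => // _.
- have xs' : x (Some s) <> white by have := @reach_conn _ _ rx (i :: s); rewrite xisE; apply.
  have rE : rank x (i :: s) = omap S (rank x s) by rewrite /= xisE.
  rewrite (@rate_sum_local _ _ (fun y => g (omap S (rank y s))) _ (i :: s))//; last first.
    by move=> u c us _ /=; rewrite recolor_neq ?xisE// Some_neq.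
  rewrite (IH (fun o => g (omap S o))) -?rE//.
  rewrite [X in _ - X]move_sum_eq0 ?subr0; last first.
    by move=> c _; rewrite rank_recolor_child -rE.
  rewrite rE.
  rewrite /move_sum (@rank_blue (recolor _ _ blue)) ?recolor_eq//.
  rewrite (@rank_dead (recolor _ _ dead)) ?recolor_eq//.
  rewrite /rate xisE ?color_eqE /= mulr0 mul0r add0r mulr1.
  case rsE : (rank x s) => [[|j]|] /=.
  + by rewrite (rank0 rsE) color_eqE /=; ring.
  + by rewrite (rankS rsE) color_eqE /= -[in RHS]natr1; ring.
  + have -> : x (Some s) == blue = false.
      by apply/eqP => /rank_blue; rewrite rsE.
    by move: gx; rewrite rE rsE /= => ->; ring.
- rewrite (rank_blue xisE) in gx *; apply: rate_sum_eq0 => u c uc.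
  suff -> : rank (recolor x (Some u) c) (i :: s) = Some 0%N by [].
  apply: rank_blue; have [e|us] := eqVneq u (i :: s); last first.
    by rewrite recolor_neq ?xisE// Some_neq.
  by move: uc; rewrite e /rate xisE ?color_eqE; case: c; rewrite ?mulr0 ?eqxx.
- rewrite (rank_dead xisE) in gx *; apply: rate_sum_eq0 => u c uc.
  suff -> : rank (recolor x (Some u) c) (i :: s) = None by [].
  apply: rank_dead; have [e|us] := eqVneq u (i :: s); last first.
    by rewrite recolor_neq ?xisE// Some_neq.
  by move: uc; rewrite e /rate xisE ?color_eqE; case: c; rewrite ?mulr0 ?eqxx.
Qed.

Lemma rate_sum_rank_white N k x i s (g : option nat -> R) : reachable k x ->
  (size s < N)%N -> x (Some (i :: s)) = white -> g None = 0 ->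
  rate_sum N (fun y => g (rank y (i :: s))) x =
  lam * (x (Some s) == red)%:R * g (omap S (rank x s)).
Proof.
move=> rx sN xw g0.
rewrite (@rate_sum_local _ _ (fun=> 0) _ (i :: s))//; last first.
  by move=> u c us _; rewrite rank_white// recolor_neq// Some_neq.
rewrite [rate_sum _ _ _]rate_sum_eq0// [X in _ - X]move_sum_eq0// subr0 add0r.
rewrite /move_sum /rate xw !color_eqE /= !mulr0 !mul0r !addr0.
by rewrite recolor_eq rank_recolor_child.
Qed.

Definition wt (w : nat -> R) (o : option nat) : R := oapp w 0 o.

Definition pair_wt w i s y : R :=
  (y (Some (i :: s)) == white)%:R * wt w (rank y s).

(** Ranks start at 1 here: a white child of a blue vertex never changes again. *)
Definition pair_sum M (F : nat -> R) x : R :=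
  \sum_(s <- words M) \sum_(i < d)
    (x (Some (i :: s)) == white)%:R * (if rank x s is Some j.+1 then F j.+1 else 0).

Lemma rate_sum_pair_nonwhite N w i s (Phi : R -> R) x : Phi 0 = 0 ->
  x (Some (i :: s)) <> white ->
  rate_sum N (fun y => Phi (pair_wt w i s y - pair_wt w i s x)) x = 0.
Proof.
move=> P0 xw; have p0 : pair_wt w i s x = 0.
  by rewrite /pair_wt; case: eqP => // _; rewrite mul0r.
apply: rate_sum_eq0 => u c uc; rewrite p0 subr0 /pair_wt.
suff /negPf -> : recolor x (Some u) c (Some (i :: s)) != white by rewrite mul0r.
have [e|us] := eqVneq u (i :: s); last first.
  by rewrite recolor_neq; [exact/eqP | exact: Some_neq].
by rewrite -e recolor_eq; case: c uc; rewrite /= ?color_eqE ?eqxx.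
Qed.

Lemma rate_sum_pair_white N k w i s (Phi : R -> R) x : reachable k x ->
  w 0%N = 0 -> Phi 0 = 0 -> (size s < N)%N -> x (Some (i :: s)) = white ->
  rate_sum N (fun y => Phi (pair_wt w i s y - pair_wt w i s x)) x =
  rate_sum N (fun y => Phi (wt w (rank y s) - wt w (rank x s))) x +
  (if rank x s is Some j.+1 then lam * Phi (- w j.+1) else 0).
Proof.
move=> rx w0 P0 sN xw.
have px : pair_wt w i s x = wt w (rank x s) by rewrite /pair_wt xw eqxx mul1r.
rewrite (@rate_sum_local _ _ (fun y => Phi (wt w (rank y s) - wt w (rank x s))) _ (i :: s))//;
  last first.
  move=> u c us uc; rewrite px /pair_wt recolor_neq; last exact: Some_neq.
  by rewrite xw eqxx mul1r.
rewrite -addrA; congr (_ + _).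
rewrite [X in _ - X]move_sum_eq0 ?subr0; last first.
  by move=> c _; rewrite rank_recolor_child subrr.
rewrite /move_sum /rate xw !color_eqE /= !mulr0 !mul0r !addr0 px.
rewrite /pair_wt recolor_eq color_eqE mul0r sub0r.
case rE : (rank x s) => [[|j]|] /=.
- by rewrite w0 oppr0 P0 mulr0.
- by rewrite (rankS rE) eqxx mulr1.
- by rewrite oppr0 P0 mulr0.
Qed.

(** A white vertex is the child of exactly one pair, except for the root, which is
never white; no pair reaches below depth [M]. *)
Lemma sum_white_children M k (F : nat -> R) x : reachable k x -> (k < M)%N ->
  \sum_(s <- words M) (x (Some s) == white)%:R *
    (if s is i :: t then (if rank x t is Some j.+1 then F j.+1 else 0) else 0)
  = pair_sum M F x.
Proof.
move=> rx; case: M => // M; rewrite ltnS => kM; rewrite big_words mulr0 add0r.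
rewrite /pair_sum (@words_widen M M.+1)//; first by rewrite exchange_big.
move=> s Ms; apply: big1 => i _.
by rewrite rank_white ?mulr0// (reach_size rx)// (leq_ltn_trans kM).
Qed.

(** Used for the identity and for the norm. A vertex that turns red brings [d] new
pairs; [sum_white_children] charges them to the pair whose child it was. *)
Lemma rate_sum_pair M N k w (Phi : R -> R) x : reachable k x ->
  w 0%N = 0 -> Phi 0 = 0 -> (k < M < N)%N ->
  \sum_(s <- words M) \sum_(i < d)
     rate_sum N (fun y => Phi (pair_wt w i s y - pair_wt w i s x)) x =
  pair_sum M (fun j => Phi (w j.-1 - w j) + j%:R * rho * Phi (- w j) +
     lam * Phi (- w j) + lam * d%:R * Phi (w j.+1)) x.
Proof.
move=> rx w0 P0 /andP[kM MN].
pose F1 j := Phi (w j.-1 - w j) + j%:R * rho * Phi (- w j) + lam * Phi (- w j).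
pose F2 j := lam * d%:R * Phi (w j.+1).
have -> : pair_sum M (fun j => Phi (w j.-1 - w j) + j%:R * rho * Phi (- w j) +
     lam * Phi (- w j) + lam * d%:R * Phi (w j.+1)) x =
  pair_sum M F1 x + pair_sum M F2 x.
  rewrite /pair_sum -big_split; apply: eq_bigr => s _.
  rewrite -big_split; apply: eq_bigr => i _ /=.
  by rewrite -mulrDr; congr (_ * _); case: (rank x s) => [[|j]|]; rewrite ?addr0.
rewrite -(sum_white_children F2 rx kM) /pair_sum -big_split /=.
rewrite big_seq [RHS]big_seq; apply: eq_bigr => s; rewrite mem_words => sM.
have sN : (size s < N)%N by exact: leq_ltn_trans MN.
have [xs|/eqP xs] := eqVneq (x (Some s)) white; last first.
  rewrite mul0r addr0; apply: eq_bigr => i _.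
  have [xis|/eqP xis] := eqVneq (x (Some (i :: s))) white; last first.
    by rewrite mul0r rate_sum_pair_nonwhite.
  rewrite mul1r (rate_sum_pair_white rx)//.
  rewrite (@rate_sum_rank _ _ _ _ (fun o => Phi (wt w o - wt w (rank x s))) rx) ?(ltnW sN)//;
    last by rewrite subrr.
  by rewrite /F1; case: (rank x s) => [[|j]|] /=; rewrite ?sub0r ?addr0.
have xis i : x (Some (i :: s)) = white.
  by apply: contrapT => /(reach_conn rx).
rewrite [X in _ = X + _]big1 ?add0r ?mul1r; last first.
  by move=> i _; rewrite rank_white ?mulr0.
transitivity (\sum_(i < d) rate_sum N (fun y => Phi (wt w (rank y s))) x).
  apply: eq_bigr => i _; rewrite (rate_sum_pair_white rx)// rank_white//= addr0.
  by apply: eq_bigr => u _; apply: eq_move_sum => c _; rewrite subr0.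
rewrite sumr_const card_ord.
case: s xs sM sN xis => [/(reach_root rx)//|i t] xs sM sN _.
rewrite (@rate_sum_rank_white _ _ _ _ _ (fun o => Phi (wt w o)) rx)//=; last exact: ltnW.
rewrite /F2 -[_ *+ d]mulr_natr; case rE : (rank x t) => [[|j]|] /=.
- by rewrite (rank0 rE) color_eqE /= mulr0 !mul0r.
- by rewrite (rankS rE) eqxx mulr1; ring.
- by rewrite P0 mulr0 mul0r.
Qed.

Lemma rate_sum_sum N (I : Type) (r : seq I) (F : I -> state -> R) x :
  rate_sum N (fun y => \sum_(i <- r) F i y) x = \sum_(i <- r) rate_sum N (F i) x.
Proof.
rewrite /rate_sum [RHS]exchange_big; apply: eq_bigr => s _.
by rewrite /move_sum !mulr_sumr -!big_split.
Qed.

(** By the hypothesis on [r], the vertices that are already red contribute 0. *)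
Lemma rate_sum_rank_sum N M k (r : nat -> R) x : reachable k x -> (M < N)%N ->
  (forall j, r j - r j.+1 - j.+1%:R * rho * r j.+1 = 0) ->
  \sum_(s <- words M) rate_sum N (fun y => wt r (rank y s) - wt r (rank x s)) x =
  \sum_(s <- words M) (x (Some s) == white)%:R *
    (if s is i :: t then (if rank x t is Some j.+1 then lam * r j.+2 else 0) else 0).
Proof.
move=> rx MN r0.
rewrite big_seq [RHS]big_seq; apply: eq_bigr => s; rewrite mem_words => sM.
have sN : (size s < N)%N by exact: leq_ltn_trans MN.
have [xs|/eqP xs] := eqVneq (x (Some s)) white; last first.
  rewrite mul0r.
  rewrite (@rate_sum_rank _ _ _ _ (fun o => wt r o - wt r (rank x s)) rx) ?(ltnW sN)//;
    last by rewrite subrr.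
  case: (rank x s) => [[|j]|] //=; rewrite sub0r mulrN; exact: r0.
rewrite mul1r; case: s xs sM sN => [/(reach_root rx)//|i t] xs sM sN.
rewrite (@rate_sum_rank_white _ _ _ _ _
  (fun o => wt r o - wt r (rank x (i :: t))) rx)//=; first last.
- by rewrite xs subrr.
- exact: ltnW.
case rE : (rank x t) => [[|j]|] /=.
- by rewrite (rank0 rE) color_eqE /= mulr0 mul0r.
- by rewrite (rankS rE) eqxx mulr1 xs /= subr0.
- by rewrite xs /= subrr mulr0.
Qed.

End Tree.

(** * The rates of chase-escape with death *)

Lemma fsum_singleton (R : nmodType) (I : choiceType) (A : set I) (e : I) (b : bool)
    (a : R) : (forall i, A i <-> i = e /\ b) ->
  (\sum_(i \in A) a)%R = if b then a else 0.
Proof.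
move=> Ae; have -> : A = if b then [set e] else set0.
  apply/seteqP; split=> i; first by move=> /Ae[-> ->].
  by case: b Ae => // Ae /= -> ; apply/Ae.
by case: b {Ae}; rewrite ?fsbig_set1 ?fsbig_set0.
Qed.

Section Chain.
Context {R : realType} {d : nat}.
Variables (lam rho : R).
Hypotheses (lam0 : 0 < lam) (rho0 : 0 < rho).
Local Notation state := (vertex d -> color).
Local Notation word := (seq 'I_d).
Local Notation rate := (@rate R d lam rho).
Local Notation move_sum := (@move_sum R d lam rho).
Local Notation rate_sum := (@rate_sum R d lam rho).
Local Notation reachable := (@reachable R d).
Local Notation Q := (ced_rate (@tree_adj d) lam rho).
Implicit Types (x y : state) (s t u : word) (M N k : nat).

Lemma recolor_other x s t c : t != s ->
  recolor x (Some s) c (Some t) = x (Some t).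
Proof. by move=> ts; rewrite recolor_neq//; apply: contra ts => /eqP[->]. Qed.

Lemma rate_ge0 x s c : 0 <= rate x s c.
Proof. by case: c => //=; rewrite mulr_ge0// ltW. Qed.

Lemma rate_neq x s c : rate x s c != 0 -> c != x (Some s).
Proof.
apply: contraNneq => ->; case E : (x (Some s)) => //=.
- by rewrite E color_eqE mulr0.
- by rewrite E color_eqE.
- by rewrite E color_eqE mulr0.
Qed.

Lemma rate_nonwhite x s c : rate x s c != 0 -> c != white.
Proof. by case: c; rewrite /= ?color_eqE ?eqxx. Qed.

Lemma rate_red x s : rate x s red != 0 -> x (Some s) = white /\ x (par s) = red.
Proof. by rewrite mulf_eq0 negb_or pnatr_eq0 eqb0 negbK => /and3P[_ /eqP-> /eqP->]. Qed.

Lemma rate_blue x s : rate x s blue != 0 -> x (Some s) = red /\ x (par s) = blue.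
Proof. by rewrite pnatr_eq0 eqb0 negbK => /andP[/eqP-> /eqP->]. Qed.

Lemma rate_dead x s : rate x s dead != 0 -> x (Some s) = red.
Proof. by rewrite mulf_eq0 negb_or pnatr_eq0 eqb0 negbK => /andP[_ /eqP->]. Qed.

Lemma rate_not_blue x s c : rate x s c != 0 -> x (Some s) <> blue.
Proof.
case: c; first by rewrite /= eqxx.
- by move=> /rate_red[->].
- by move=> /rate_blue[->].
- by move=> /rate_dead ->.
Qed.

Lemma rate_par_nonwhite k x s c : reachable k x -> rate x s c != 0 ->
  x (par s) <> white.
Proof.
move=> rx; case: c; first by rewrite /= eqxx.
- by move=> /rate_red[_ ->].
- by move=> /rate_blue[_ ->].
- by move=> /rate_dead xs; apply: (reach_conn rx); rewrite xs.
Qed.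

Lemma child_white k x i s : reachable k x -> x (Some s) = white ->
  x (Some (i :: s)) = white.
Proof. by move=> rx xs; apply: contrapT => /(reach_conn rx). Qed.

Lemma rate_size k x s c : reachable k x -> rate x s c != 0 -> (size s <= k.+1)%N.
Proof.
move=> rx /(rate_par_nonwhite rx); case: s => // i s /= xs.
by rewrite ltnS leqNgt; apply/negP => /(reach_size rx).
Qed.

Lemma reachableS k x : reachable k x -> reachable k.+1 x.
Proof.
case=> *; split => //.
  by move=> s ks; auto using ltnW.
by move=> M; apply: (@le_trans _ _ k.+1%:R) => //; rewrite ler_nat.
Qed.

Lemma recolor_inj x v c v' c' : c != x v ->
  recolor x v c = recolor x v' c' -> v' = v /\ c' = c.
Proof.
move=> cx /(congr1 (fun f => f v)); rewrite recolor_eq /recolor.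
by have [->|_ e] := eqVneq v v' => //; rewrite e eqxx in cx.
Qed.

Lemma recolor_id x v c : recolor x v c = x -> c = x v.
Proof. by move/(congr1 (fun f => f v)); rewrite recolor_eq. Qed.

Lemma reachable_step k x s c : reachable k x -> rate x s c != 0 ->
  reachable k.+1 (recolor x (Some s) c).
Proof.
move=> rx rc; have cw := rate_nonwhite rc.
have nw v : x v <> white -> recolor x (Some s) c v <> white.
  by rewrite /recolor; case: eqP => // _ _; apply/eqP.
split.
- by rewrite recolor_neq// (reach_extra rx).
- exact/nw/(reach_root rx).
- move=> t; have [->|ts] := eqVneq t s.
    by move=> _; apply/nw/(rate_par_nonwhite rx rc).
  rewrite (recolor_other _ _ ts) => xt.
  exact: nw (reach_conn rx xt).
- move=> t; have [->|ts] := eqVneq t s.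
    rewrite recolor_eq recolor_neq ?par_neq// => cb; rewrite cb in rc.
    by have [] := rate_blue rc.
  rewrite (recolor_other _ _ ts) => xt; have xp := reach_blue rx xt.
  by rewrite /recolor; case: eqP => // e; case: (rate_not_blue rc); rewrite -e.
- move=> t kt; have ts : t != s.
    by apply: contraTneq kt => ->; rewrite -leqNgt (rate_size rx rc).
  by rewrite (recolor_other _ _ ts); apply: (reach_size rx); exact: ltnW.
- move=> M; rewrite -natr1.
  have [sM|sM] := leqP (size s) M; last first.
    apply: (@le_trans _ _ k.+1%:R); last by rewrite lerDl.
    apply: le_trans (reach_count rx M); rewrite big_seq [leRHS]big_seq.
    apply: ler_sum => t; rewrite mem_words => tM; have ts : t != s.
      by apply: contraTneq tM => ->; rewrite -ltnNge.
    by rewrite (recolor_other _ _ ts).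
  rewrite (bigD1_seq s) ?mem_words ?words_uniq//= addrC lerD//; last by case: (_ != _).
  apply: le_trans (reach_count rx M).
  rewrite [leRHS](bigD1_seq s) ?mem_words ?words_uniq//=.
  apply: ler_wpDl => //; apply: ler_sum => t ts.
  by rewrite (recolor_other _ _ ts).
Qed.

Lemma tree_adjE (v : vertex d) s : tree_adj v (Some s) <->
  v = par s \/ exists i, v = Some (i :: s).
Proof.
rewrite /tree_adj; have -> : is_parent v (Some s) = (v == par s) by case: s.
split=> [/orP[/eqP|]|[->|[i ->]]]; [by left|..].
- by case: v => [[|i t]|] //= /eqP[<-]; right; exists i.
- by rewrite eqxx.
- by rewrite /= eqxx orbT.
Qed.

(** Each of the three sums in [ced_rate] has at most one term: children of white
vertices are white and parents of blue vertices are blue, so that an edge never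
acts upwards. *)
Lemma ced_rate_recolor k x s c : reachable k x -> c != x (Some s) -> c != white ->
  Q x (recolor x (Some s) c) = rate x s c.
Proof.
move=> rx cx cw; rewrite /ced_rate.
rewrite (@fsum_singleton _ _ _ (par s, Some s)
   [&& c == red, x (Some s) == white & x (par s) == red]); last first.
  move=> [v1 v2] /=; split.
    move=> [a x1 x2 /(recolor_inj cx)[e1 e2]]; rewrite {v2}e1 in a x2 *.
    move/tree_adjE : a => [e|[i e]]; rewrite {v1}e in x1 *.
      by rewrite -e2 x2 x1 !eqxx.
    by rewrite (child_white i rx x2) in x1.
  move=> [[-> ->]] /and3P[/eqP-> /eqP-> /eqP->]; split => //.
  by apply/tree_adjE; left.
rewrite (@fsum_singleton _ _ _ (par s, Some s)
   [&& c == blue, x (Some s) == red & x (par s) == blue]); last first.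
  move=> [v1 v2] /=; split.
    move=> [a x1 x2 /(recolor_inj cx)[e1 e2]]; rewrite {v2}e1 in a x2 *.
    move/tree_adjE : a => [e|[i e]]; rewrite {v1}e in x1 *.
      by rewrite -e2 x2 x1 !eqxx.
    by have := reach_blue rx x1; rewrite /= x2.
  move=> [[-> ->]] /and3P[/eqP-> /eqP-> /eqP->]; split => //.
  by apply/tree_adjE; left.
rewrite (@fsum_singleton _ _ _ (Some s : vertex d)
   ((c == dead) && (x (Some s) == red))); last first.
  move=> v /=; split.
    by move=> [xv /(recolor_inj cx)[e1 e2]]; rewrite e1 in xv *; rewrite -e2 xv !eqxx.
  by move=> [->] /andP[/eqP-> /eqP->].
case: c cw {cx}; rewrite ?color_eqE //= => _; rewrite ?add0r ?addr0;
 by do 2?[case: (_ == _)]; rewrite ?mulr1 ?mulr0.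
Qed.

Lemma ced_rate_support k x y : reachable k x -> Q x y != 0 ->
  exists s c, rate x s c != 0 /\ y = recolor x (Some s) c.
Proof.
move=> rx; apply: contraPP => H; apply/negP; rewrite negbK; apply/eqP.
have noS s c : c != x (Some s) -> c != white -> y = recolor x (Some s) c ->
    rate x s c = 0.
  move=> cx cw ye; apply/eqP/negPn/negP => rc; apply: H; by exists s, c.
have H1 s : x (Some s) = white -> x (par s) = red -> y = recolor x (Some s) red -> False.
  move=> xs xp ye; have := @noS s red; rewrite xs !color_eqE => /(_ isT isT ye) /=.
  by rewrite xs xp !color_eqE mulr1 => h; move: lam0; rewrite h ltxx.
have H2 s : x (Some s) = red -> x (par s) = blue -> y = recolor x (Some s) blue -> False.
  move=> xs xp ye; have := @noS s blue; rewrite xs !color_eqE => /(_ isT isT ye) /=.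
  by rewrite xs xp !color_eqE => /eqP; rewrite oner_eq0.
have H3 s : x (Some s) = red -> y = recolor x (Some s) dead -> False.
  move=> xs ye; have := @noS s dead; rewrite xs !color_eqE => /(_ isT isT ye) /=.
  by rewrite xs !color_eqE mulr1 => h; move: rho0; rewrite h ltxx.
rewrite /ced_rate.
rewrite (@fsum_singleton _ _ _ (None, None) false); last first.
  move=> [v1 v2] /=; split => [[a x1 x2 ye]|[_ //]]; exfalso.
  case: v2 => [s|] in a x2 ye *; last by rewrite (reach_extra rx) in x2.
  move/tree_adjE : a => [e|[i e]]; rewrite {v1}e in x1 *; first exact: H1 ye.
  by rewrite (child_white i rx x2) in x1.
rewrite (@fsum_singleton _ _ _ (None, None) false); last first.
  move=> [v1 v2] /=; split => [[a x1 x2 ye]|[_ //]]; exfalso.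
  case: v2 => [s|] in a x2 ye *; last by rewrite (reach_extra rx) in x2.
  move/tree_adjE : a => [e|[i e]]; rewrite {v1}e in x1 *; first exact: H2 ye.
  by have := reach_blue rx x1; rewrite /= x2.
rewrite (@fsum_singleton _ _ _ None false) ?addr0//.
move=> v /=; split => [[xv ye]|[_ //]]; exfalso.
case: v => [s|] in xv ye *; last by rewrite (reach_extra rx) in xv.
exact: H3 ye.
Qed.

End Chain.

(** * The jump chain *)

Section Kernel.
Context {R : realType} {d : nat}.
Variables (lam rho : R).
Hypotheses (lam0 : 0 < lam) (rho0 : 0 < rho).
Local Notation state := (vertex d -> color).
Local Notation word := (seq 'I_d).
Local Notation rate := (@rate R d lam rho).
Local Notation move_sum := (@move_sum R d lam rho).
Local Notation rate_sum := (@rate_sum R d lam rho).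
Local Notation reachable := (@reachable R d).
Local Notation Q := (ced_rate (@tree_adj d) lam rho).
Implicit Types (x y : state) (s t u : word) (M N k n : nat) (f g : state -> R).

Definition tot_rate N x : R := rate_sum N (fun=> 1) x.

Definition moves N x : seq (word * color) :=
  [seq sc <- [seq (s, c) | s <- words N, c <- [:: red; blue; dead]]
     | rate x sc.1 sc.2 != 0].

Definition moved N x : seq state :=
  [seq recolor x (Some sc.1) sc.2 | sc <- moves N x].

Definition succ N x : seq state := if tot_rate N x == 0 then [:: x] else moved N x.

Lemma sum_moves N F x :
  \sum_(sc <- moves N x) rate x sc.1 sc.2 * F (recolor x (Some sc.1) sc.2) =
  rate_sum N F x.
Proof.
rewrite big_filter big_mkcond big_allpairs_dep; apply: eq_bigr => s _.
rewrite /= !big_cons big_nil.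
have h c : (if rate x s c != 0 then rate x s c * F (recolor x (Some s) c) else 0)
  = rate x s c * F (recolor x (Some s) c).
  by case: eqP => //= ->; rewrite mul0r.
rewrite !h /move_sum -addrA; congr (_ + (_ + _)); exact: addr0.
Qed.

Lemma moves_uniq N x : uniq (moves N x).
Proof.
rewrite filter_uniq// allpairs_uniq//; first exact: words_uniq.
  by rewrite /= !inE !color_eqE.
by move=> [s c] [t c'] _ _ /= [-> ->].
Qed.

Lemma mem_moves N x sc : sc \in moves N x -> rate x sc.1 sc.2 != 0.
Proof. by rewrite mem_filter => /andP[]. Qed.

Lemma moves_mem k N x s c : reachable k x -> (k < N)%N -> rate x s c != 0 ->
  (s, c) \in moves N x.
Proof.
move=> rx kN rc; rewrite mem_filter rc; apply/allpairsPdep; exists s, c.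
split=> //; first by rewrite mem_words (leq_trans (rate_size rx rc)).
by have := rate_nonwhite rc; rewrite !inE; case: (c); rewrite !color_eqE.
Qed.

Lemma moved_uniq N x : uniq (moved N x).
Proof.
rewrite map_inj_in_uniq ?moves_uniq// => -[s c] [t c'] /mem_moves/= rc _ /= e.
by have [[->] ->] := recolor_inj (rate_neq rc) e.
Qed.

Lemma moved_neq N x y : y \in moved N x -> y != x.
Proof.
move=> /mapP[[s c] /mem_moves/= rc ->]; apply/eqP => /recolor_id e.
by have := rate_neq rc; rewrite e eqxx.
Qed.

Lemma total_rateE k N x : reachable k x -> (k < N)%N ->
  total_rate Q x = tot_rate N x.
Proof.
move=> rx kN; rewrite /total_rate (@fsbigE _ _ _ _ _ (moved N x)).
- rewrite /moved big_map /tot_rate -sum_moves.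
  rewrite big_mkcond; apply: eq_big_seq => -[s c] scm.
  have /mem_moves/= rc := scm.
  rewrite ifT; last by apply/mem_set/(@moved_neq N)/mapP; exists (s, c).
  by rewrite mulr1 (ced_rate_recolor _ _ rx)// ?(rate_neq rc)// (rate_nonwhite rc).
- exact: moved_uniq.
- by move=> y /= /moved_neq.
- move=> y _ ym; apply: contraNeq ym => /(ced_rate_support lam0 rho0 rx)[s [c [rc ->]]].
  by apply/mapP; exists (s, c) => //; apply: moves_mem kN _.
Qed.

Lemma ced_rate_ge0 x y : 0 <= Q x y.
Proof.
by rewrite /ced_rate !addr_ge0// fsumr_ge0// => i _; rewrite ltW.
Qed.

Lemma jump_prob_ge0 x y : 0 <= jump_prob Q x y.
Proof.
rewrite /jump_prob; case: ifP => // _; case: ifP => // _.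
by rewrite divr_ge0 ?ced_rate_ge0// fsumr_ge0// => z _; exact: ced_rate_ge0.
Qed.

Definition kernel N f x : R := \sum_(y <- succ N x) jump_prob Q x y * f y.

Lemma rate_sum_linear N (a b : R) F G x :
  rate_sum N (fun y => a * F y + b * G y) x = a * rate_sum N F x + b * rate_sum N G x.
Proof.
rewrite /rate_sum !mulr_sumr -big_split; apply: eq_bigr => s _ /=.
by rewrite /move_sum; ring.
Qed.

(** In an absorbing state both sides are [f x], as division by 0 gives 0. *)
Lemma kernelE k N f x : reachable k x -> (k < N)%N ->
  kernel N f x = f x + rate_sum N (fun y => f y - f x) x / tot_rate N x.
Proof.
move=> rx kN; have tE := total_rateE rx kN.
rewrite /kernel /succ; have [t0|t0] := eqVneq (tot_rate N x) 0.
  by rewrite big_seq1 /jump_prob tE t0 !eqxx mul1r invr0 mulr0 addr0.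
have -> : rate_sum N (fun y => f y - f x) x = rate_sum N f x - f x * tot_rate N x.
  rewrite -[rate_sum N f x]mul1r -mulNr /tot_rate -rate_sum_linear.
  by apply: eq_bigr => s _; rewrite /move_sum; ring.
rewrite mulrBl mulfK// addrC subrK -sum_moves mulr_suml.
rewrite /moved big_map; apply: eq_big_seq => -[s c] /mem_moves/= rc.
rewrite /jump_prob tE (negPf t0) (ced_rate_recolor _ _ rx) ?(rate_neq rc) ?(rate_nonwhite rc)//.
case: eqP => [/recolor_id e|_]; first by have := rate_neq rc; rewrite e eqxx.
by rewrite mulrAC.
Qed.

Lemma reachable_succ k N x y : reachable k x -> y \in succ N x -> reachable k.+1 y.
Proof.
move=> rx; rewrite /succ; case: ifP => _.
  by rewrite inE => /eqP ->; exact: reachableS.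
by move=> /mapP[[s c] /mem_moves/= rc ->]; exact: reachable_step rc.
Qed.

Lemma kernel_le k N f g x : reachable k x ->
  (forall y, reachable k.+1 y -> f y <= g y) -> kernel N f x <= kernel N g x.
Proof.
move=> rx fg; rewrite /kernel big_seq [leRHS]big_seq; apply: ler_sum => y ys.
by rewrite ler_wpM2l ?jump_prob_ge0//; apply: fg; exact: reachable_succ rx ys.
Qed.

Lemma iter_kernel_le k N n f g x : reachable k x ->
  (forall y, reachable (k + n) y -> f y <= g y) ->
  iter n (kernel N) f x <= iter n (kernel N) g x.
Proof.
elim: n k x => [|n IH] k x rx fg; first by apply: fg; rewrite addn0.
rewrite !iterS; apply: kernel_le rx _ => y ry; apply: IH ry _ => z.
by rewrite addSnnS; exact: fg.
Qed.

Lemma iter_kernel_ge0 N n f x : (forall y, 0 <= f y) ->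
  0 <= iter n (kernel N) f x.
Proof.
move=> f0; elim: n x => //= n IH x; apply: sumr_ge0 => y _.
by rewrite mulr_ge0 ?jump_prob_ge0.
Qed.

Lemma iter_kernel_super k N n f x : reachable k x ->
  (forall i y, (i < n)%N -> reachable (k + i) y -> kernel N f y <= f y) ->
  iter n (kernel N) f x <= f x.
Proof.
elim: n => // n IH rx fs; rewrite iterSr.
apply: (@le_trans _ _ (iter n (kernel N) f x)).
  by apply: iter_kernel_le rx _ => y; exact: fs.
by apply: IH => // i y ni; apply: fs; exact: ltnW.
Qed.

Lemma iter_kernel_sub k N n f x : reachable k x ->
  (forall i y, (i < n)%N -> reachable (k + i) y -> f y <= kernel N f y) ->
  f x <= iter n (kernel N) f x.
Proof.
elim: n => // n IH rx fs; rewrite iterSr.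
apply: (@le_trans _ _ (iter n (kernel N) f x)).
  by apply: IH => // i y ni; apply: fs; exact: ltnW.
by apply: iter_kernel_le rx _ => y; exact: fs.
Qed.

Lemma iter_kernel_sub_le k N n m f x : reachable k x -> (n <= m)%N ->
  (forall i y, (i < m)%N -> reachable (k + i) y -> f y <= kernel N f y) ->
  iter n (kernel N) f x <= iter m (kernel N) f x.
Proof.
move=> rx nm fs; rewrite -(subnKC nm) iterD; apply: iter_kernel_le rx _ => y ry.
apply: iter_kernel_sub ry _ => i z ni; rewrite -addnA; apply: fs.
by rewrite -(subnKC nm) ltn_add2l.
Qed.

Lemma iter_kernel_linear N n (a b : R) f g x :
  iter n (kernel N) (fun y => a * f y + b * g y) x =
  a * iter n (kernel N) f x + b * iter n (kernel N) g x.
Proof.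
elim: n x => // n IH x; rewrite !iterS /kernel !mulr_sumr -big_split.
by apply: eq_bigr => y _; rewrite IH /=; ring.
Qed.

Lemma iter_kernel_sum N n (I : Type) (r : seq I) (F : I -> state -> R) x :
  iter n (kernel N) (fun y => \sum_(i <- r) F i y) x =
  \sum_(i <- r) iter n (kernel N) (F i) x.
Proof.
elim: n x => // n IH x; rewrite iterS /kernel.
rewrite [RHS]exchange_big; apply: eq_bigr => y _.
by rewrite IH mulr_sumr.
Qed.

Lemma iter_kernel_cst k N n (a : R) x : reachable k x -> (k + n <= N)%N ->
  iter n (kernel N) (fun=> a) x = a.
Proof.
move=> rx kn.
have K1 i y : (i < n)%N -> reachable (k + i) y -> kernel N (fun=> a) y = a.
  move=> ni ry; rewrite (kernelE _ ry); last by rewrite (leq_trans _ kn)// ltn_add2l.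
  rewrite [rate_sum _ _ _]rate_sum_eq0 ?mul0r ?addr0// => u c _; exact: subrr.
apply/eqP; rewrite eq_le; apply/andP; split.
  by apply: iter_kernel_super rx _ => i y ni ry; rewrite (K1 i y).
by apply: iter_kernel_sub rx _ => i y ni ry; rewrite (K1 i y).
Qed.

Lemma ced_init_reachable : reachable 0 (@ced_init d).
Proof.
split=> //.
- by case=> [|i [|j s]].
- by case=> [|i s].
- by case.
- case=> [|M]; first by rewrite big_seq1; case: (_ != _).
  rewrite big_words big1 ?addr0; last first.
    by move=> i _; apply: big1 => s _; rewrite /= eqxx.
  by case: (_ != _).
Qed.

Lemma rank_init s : rank (@ced_init d) s = if s is [::] then Some 1%N else None.
Proof. by case: s. Qed.

Lemma rate_sum_le N F G x : (forall s c, rate x s c != 0 ->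
   F (recolor x (Some s) c) <= G (recolor x (Some s) c)) ->
  rate_sum N F x <= rate_sum N G x.
Proof.
move=> FG; apply: ler_sum => s _; rewrite /move_sum.
have h c : rate x s c * F (recolor x (Some s) c) <= rate x s c * G (recolor x (Some s) c).
  have [->|rc] := eqVneq (rate x s c) 0; first by rewrite !mul0r.
  by rewrite ler_wpM2l ?rate_ge0// FG.
by rewrite !lerD.
Qed.

Lemma tot_rate_ge0 N x : 0 <= tot_rate N x.
Proof.
apply: sumr_ge0 => s _; rewrite /move_sum !mulr1.
by rewrite !addr_ge0// mulr_ge0// ltW.
Qed.

Lemma tot_rate_ge N x s : (size s <= N)%N -> x (Some s) = red -> rho <= tot_rate N x.
Proof.
move=> sN xs; rewrite /tot_rate (rate_sumD1 _ _ _ _ sN); apply: ler_wpDr.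
  apply: sumr_ge0 => t _; rewrite /move_sum !mulr1.
  by rewrite !addr_ge0// mulr_ge0// ltW.
by rewrite /move_sum !mulr1 /rate xs !color_eqE /= mulr0 add0r mulr1 lerDr.
Qed.

(** A red vertex infects its [d] children at rate [lam] each; all other moves
happen at non-white vertices. *)
Lemma tot_rate_le k N x : reachable k x -> (k < N)%N ->
  tot_rate N x <= (lam * d%:R + (1 + rho)) * k.+1%:R.
Proof.
move=> rx; case: N => // N kN.
have cnt_le M (b : word -> bool) : (forall s, b s -> x (Some s) != white) ->
    \sum_(s <- words M) (b s)%:R <= k.+1%:R :> R.
  move=> bx; apply: le_trans (reach_count rx M); apply: ler_sum => s _.
  by rewrite ler_nat; case: (b s) (bx s) => // ->.
rewrite mulrDl; apply: (@le_trans _ _ (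
   \sum_(s <- words N.+1) rate x s red + (1 + rho) * \sum_(s <- words N.+1) (x (Some s) == red)%:R)).
  rewrite mulr_sumr -big_split; apply: ler_sum => s _ /=.
  rewrite /move_sum !mulr1 -addrA lerD2l mulrDl mul1r lerD2r.
  rewrite /rate ler_nat; by case: (x (Some s) == red); case: (x (par s) == blue).
apply: lerD; last first.
  rewrite ler_wpM2l ?addr_ge0 ?(ltW rho0)//; apply: cnt_le => s /eqP ->.
  by rewrite color_eqE.
rewrite big_words.
have -> : rate x [::] red = 0 by rewrite /rate /= (reach_extra rx) color_eqE andbF mulr0.
rewrite add0r -mulrA mulrCA mulr_natl -[X in _ *+ X]card_ord -sumr_const.
apply: ler_sum => i _; rewrite -mulr_sumr ler_pM2l//.
apply: (@le_trans _ _ (\sum_(s <- words N) (x (Some s) == red)%:R)).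
  by apply: ler_sum => s _; rewrite ler_nat; case: (_ == white).
by apply: cnt_le => s /eqP ->; rewrite color_eqE.
Qed.

(** The number of colour changes that a vertex of this colour can still undergo. *)
Definition level (c : color) : R :=
  match c with white => 2 | red => 1 | _ => 0 end.

Definition potential W x : R := \sum_(s <- words W) level (x (Some s)).

Definition alive W x : bool := has (fun s => x (Some s) == red) (words W).

Lemma potential_ge0 W x : 0 <= potential W x.
Proof. by apply: sumr_ge0 => s _; case: (x _). Qed.

Lemma rate_sum_potential N W x : (W <= N)%N ->
  rate_sum N (fun y => potential W y - potential W x) x <= - (rho * (alive W x)%:R).
Proof.
move=> WN.
have -> : rate_sum N (fun y => potential W y - potential W x) x =
    \sum_(s <- words W) rate_sum N (fun y => level (y (Some s)) - level (x (Some s))) x.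
  rewrite -rate_sum_sum; apply: eq_bigr => t _; apply: eq_move_sum => c _.
  by rewrite /potential -sumrB.
have H s : s \in words W ->
    rate_sum N (fun y => level (y (Some s)) - level (x (Some s))) x <=
    - (rho * (x (Some s) == red)%:R).
  rewrite mem_words => sW; have sN := leq_trans sW WN.
  rewrite (@rate_sum_local _ _ _ _ _ _ (fun=> 0) _ s)//; last first.
    by move=> u c us _; rewrite (recolor_other _ _ (_ : s != u)) 1?eq_sym// subrr.
  rewrite [rate_sum _ _ _]rate_sum_eq0// [X in _ - X]move_sum_eq0// subr0 add0r.
  rewrite /move_sum /rate !recolor_eq.
  have b1 := mulr_ge0 (ltW lam0) (ler0n R (x (par s) == red)).
  have b2 := ler0n R (x (par s) == blue).
  by case: (x (Some s)); rewrite !color_eqE /=; lra.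
rewrite big_seq; apply: (@le_trans _ _ (\sum_(s <- words W | s \in words W)
    - (rho * (x (Some s) == red)%:R))); first exact: ler_sum.
rewrite -big_seq sumrN -mulr_sumr lerN2 ler_pM2l//.
rewrite /alive; case: hasP => [[s sW xs]|_]; last by apply: sumr_ge0.
rewrite (bigD1_seq s) ?words_uniq//= xs lerDl; exact: sumr_ge0.
Qed.

Lemma harmonic_unbounded n0 (c : R) : exists n, c <= \sum_(n0 <= i < n) i.+1%:R^-1.
Proof.
apply: contrapT => /forallNP h; apply: (@dvg_harmonic R).
apply: nondecreasing_is_cvgn.
  by apply: nondecreasing_series => i _ _; rewrite invr_ge0.
exists (\sum_(0 <= i < n0) harmonic i + `|c|) => _ [n _ <-].
rewrite /series /=; have [nn0|n0n] := leqP n n0.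
  apply: ler_wpDr => //; rewrite (big_cat_nat (leq0n n) nn0)//= lerDl.
  by apply: sumr_ge0 => i _; rewrite invr_ge0.
rewrite (big_cat_nat (leq0n n0) (ltnW n0n))//= lerD2l.
by have /negP := h n; rewrite -ltNge => /ltW/le_trans; apply; exact: ler_norm.
Qed.

(** As long as a vertex of [words W] is red, the bounded [potential W] drops at
rate at least [rho], hence in the [n]-th step of the chain, by [tot_rate_le], by
at least a constant times [n.+1%:R^-1] in the mean. Since the harmonic series
diverges, the probability of this cannot stay above [e]. *)
Lemma eventually_not_alive W n0 (e : R) : 0 < e ->
  exists n N, [/\ (n0 <= n)%N, (n.+1 < N)%N, (W < N)%N &
    iter n (kernel N) (fun y => (alive W y)%:R) (@ced_init d) < e].
Proof.
move=> e0; set x0 := @ced_init d.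
pose C := lam * d%:R + (1 + rho).
have C0 : 0 < C by rewrite ltr_wpDl ?mulr_ge0 ?(ltW lam0)// addr_gt0.
(* With probability at least [e] of being alive at each step from [n0] to [n1],
   the potential would become negative. *)
have [n1 n1P] := harmonic_unbounded n0 ((potential W x0 + 1) * C / (rho * e)).
pose N := (n1 + W).+2.
apply: contrapT => H.
have qe n : (n0 <= n < n1)%N -> e <= iter n (kernel N) (fun y => (alive W y)%:R) x0.
  move=> /andP[n0n nn1]; rewrite leNgt; apply/negP => h; apply: H; exists n, N.
  split=> //; first by rewrite !ltnS (leq_trans (ltnW nn1))// leq_addr.
  by rewrite ltnS leqW// leq_addl.
pose dec n : R := rho * e / C * \sum_(n0 <= i < n) i.+1%:R^-1.
have step n : (n <= n1)%N ->
    iter n (kernel N) (potential W) x0 <= potential W x0 - dec n.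
  elim: n => [|n IH] nn1.
    by rewrite /dec big_geq// mulr0 subr0.
  rewrite iterSr.
  apply: (@le_trans _ _ (iter n (kernel N)
      (fun y => 1 * potential W y + (- (rho / (C * n.+1%:R))) * (alive W y)%:R) x0)).
    apply: iter_kernel_le ced_init_reachable _ => y; rewrite add0n => ry.
    have nN : (n < N)%N by rewrite ltnS leqW// (leq_trans (ltnW nn1))// leq_addr.
    rewrite (kernelE _ ry nN) mul1r lerD2l.
    have gp := @rate_sum_potential N W y (leqW (leqW (leq_addl n1 W))).
    have gl : rate_sum N (fun z => potential W z - potential W y) y / tot_rate N y <=
        - (rho * (alive W y)%:R) / tot_rate N y.
      by rewrite ler_wpM2r// invr_ge0 tot_rate_ge0.
    apply: le_trans gl _; rewrite !mulNr lerN2.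
    have [|] := boolP (alive W y); last by rewrite /= !mulr0 mul0r.
    move=> /hasP[s]; rewrite mem_words => sW /eqP ys; rewrite !mulr1.
    have tg : rho <= tot_rate N y.
      by apply: tot_rate_ge ys; rewrite (leq_trans sW)// /N !leqW// leq_addl.
    have tp : 0 < tot_rate N y by exact: lt_le_trans tg.
    rewrite ler_pM2l// lef_pV2 ?posrE ?mulr_gt0 ?ltr0Sn//.
    exact: tot_rate_le.
  rewrite iter_kernel_linear mul1r mulNr.
  have [n0n|nn0] := leqP n0 n; last first.
    have -> : dec n.+1 = dec n by rewrite /dec !big_geq// ltnW.
    apply: le_trans (IH (ltnW nn1)); rewrite gerDl oppr_le0 mulr_ge0//.
      by rewrite divr_ge0 ?mulr_ge0// ltW.
    exact: iter_kernel_ge0.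
  have -> : dec n.+1 = dec n + rho * e / C * n.+1%:R^-1.
    by rewrite /dec big_nat_recr//= mulrDr.
  rewrite opprD addrA lerD ?IH ?(ltnW nn1)// lerN2.
  have -> : rho * e / C / n.+1%:R = rho / (C * n.+1%:R) * e.
    by field; rewrite (gt_eqF C0) andbT addrC natr1 pnatr_eq0.
  by rewrite ler_wpM2l ?qe ?n0n// divr_ge0 ?mulr_ge0// ltW.
have := step n1 (leqnn _).
have : potential W x0 + 1 <= dec n1.
  rewrite /dec -ler_pdivrMl; last by rewrite divr_gt0// mulr_gt0.
  by rewrite invf_div mulrC mulrA.
have : 0 <= iter n1 (kernel N) (potential W) x0.
  by apply: iter_kernel_ge0 => y; exact: potential_ge0.
lra.
Qed.

End Kernel.

(** * Three martingale arguments *)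

Section Functionals.
Context {R : realType} {d : nat}.
Variables (lam rho : R).
Hypotheses (d0 : (0 < d)%N) (lam0 : 0 < lam) (rho0 : 0 < rho).
Local Notation state := (vertex d -> color).
Local Notation word := (seq 'I_d).
Local Notation rate := (@rate R d lam rho).
Local Notation rate_sum := (@rate_sum R d lam rho).
Local Notation reachable := (@reachable R d).
Local Notation kernel := (@kernel R d lam rho).
Local Notation x0 := (@ced_init d).
Implicit Types (x y : state) (s t u : word) (L M N k n : nat).

Definition pairs_fun M (w : nat -> R) x : R :=
  \sum_(s <- words M) \sum_(i < d) pair_wt w i s x.

(** Each blue vertex counts for 1, each red one for its chance to turn blue. *)
Definition catch_fun M x : R :=
  \sum_(s <- words M) wt (catch_prob rho) (rank x s).

Definition nblue M x : R := \sum_(s <- words M) (x (Some s) == blue)%:R.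

Lemma pairs_fun_ge0 M w x : (forall j, 0 <= w j) -> 0 <= pairs_fun M w x.
Proof.
move=> w0; apply: sumr_ge0 => s _; apply: sumr_ge0 => i _.
by rewrite mulr_ge0//; case: (rank x s) => //=.
Qed.

Lemma pairs_fun_init M w : pairs_fun M w x0 = d%:R * w 1%N.
Proof.
rewrite /pairs_fun (@words_widen _ _ 0)//; last first.
  by case=> // i s _; apply: big1 => j _; rewrite /pair_wt rank_init /= mulr0.
rewrite big_seq1 mulr_natl -[X in _ *+ X]card_ord -sumr_const; apply: eq_bigr => i _.
by rewrite /pair_wt /= eqxx mul1r.
Qed.

Lemma catch_fun_init M : catch_fun M x0 = catch_prob rho 1.
Proof.
rewrite /catch_fun (@words_widen _ _ 0)//; last by case.
by rewrite big_seq1.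
Qed.

Lemma pairs_fun_diff M w x y : pairs_fun M w y - pairs_fun M w x =
  \sum_(s <- words M) \sum_(i < d) (pair_wt w i s y - pair_wt w i s x).
Proof. by rewrite -sumrB; apply: eq_bigr => s _; rewrite sumrB. Qed.

Lemma eq_rate_sum N F G x : (forall y, F y = G y) -> rate_sum N F x = rate_sum N G x.
Proof. by move=> FG; apply: eq_bigr => s _; apply: eq_move_sum. Qed.

Lemma rate_sumD N F G x :
  rate_sum N (fun y => F y + G y) x = rate_sum N F x + rate_sum N G x.
Proof.
by rewrite /rate_sum -big_split; apply: eq_bigr => s _; rewrite /move_sum /=; ring.
Qed.

Lemma rate_sum_pairs_fun M N k w x : reachable k x -> (k < M < N)%N -> w 0%N = 0 ->
  rate_sum N (fun y => pairs_fun M w y - pairs_fun M w x) x =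
  pair_sum M (drift d%:R lam rho w) x.
Proof.
move=> rx kMN w0; rewrite (eq_rate_sum _ _ (pairs_fun_diff M w x)) rate_sum_sum.
transitivity (\sum_(s <- words M) \sum_(i < d)
   rate_sum N (fun y => id (pair_wt w i s y - pair_wt w i s x)) x).
  by apply: eq_bigr => s _; rewrite rate_sum_sum.
rewrite (rate_sum_pair (Phi := id) lam rho rx w0 _ kMN)//; apply: eq_bigr => s _.
apply: eq_bigr => i _; congr (_ * _); case: (rank x s) => [[|j]|] //.
by rewrite /drift /=; ring.
Qed.

Lemma rate_sum_pairs_fun_abs M N k w x : reachable k x -> (k < M < N)%N ->
  w 0%N = 0 -> (forall j, 0 <= w j) ->
  rate_sum N (fun y => `|pairs_fun M w y - pairs_fun M w x|) x <=
  pair_sum M (turnover d%:R lam rho w) x.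
Proof.
move=> rx kMN w0 wge0.
apply: (@le_trans _ _ (rate_sum N (fun y => \sum_(s <- words M) \sum_(i < d)
    `|pair_wt w i s y - pair_wt w i s x|) x)).
  apply: rate_sum_le => // s c _; rewrite pairs_fun_diff.
  apply: le_trans (ler_norm_sum _ _ _) _; apply: ler_sum => t _.
  exact: ler_norm_sum.
rewrite rate_sum_sum.
under eq_bigr => s _ do rewrite rate_sum_sum.
rewrite (rate_sum_pair (Phi := Num.norm) lam rho rx w0 (normr0 _) kMN).
apply: ler_sum => s _; apply: ler_sum => i _; rewrite ler_wpM2l//.
case: (rank x s) => [[|j]|] //.
by rewrite /turnover /= !normrN !(ger0_norm (wge0 _)); lra.
Qed.

Lemma pair_sum_le M (F G : nat -> R) x : (forall j, F j.+1 <= G j.+1) ->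
  pair_sum M F x <= pair_sum M G x.
Proof.
move=> FG; apply: ler_sum => s _; apply: ler_sum => i _.
by rewrite ler_wpM2l//; case: (rank x s) => [[|j]|].
Qed.

Lemma pair_sum_le0 M (F : nat -> R) x : (forall j, F j.+1 <= 0) -> pair_sum M F x <= 0.
Proof.
move=> F0; apply: sumr_le0 => s _; apply: sumr_le0 => i _.
by rewrite mulr_ge0_le0//; case: (rank x s) => [[|j]|].
Qed.

Lemma pair_sum_ge0 M (F : nat -> R) x : (forall j, 0 <= F j.+1) -> 0 <= pair_sum M F x.
Proof.
move=> F0; apply: sumr_ge0 => s _; apply: sumr_ge0 => i _.
by rewrite mulr_ge0//; case: (rank x s) => [[|j]|].
Qed.

Lemma pair_sumZ M a (F : nat -> R) x : pair_sum M (fun j => a * F j) x = a * pair_sum M F x.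
Proof.
rewrite /pair_sum mulr_sumr; apply: eq_bigr => s _.
rewrite mulr_sumr; apply: eq_bigr => i _; rewrite mulrCA; congr (_ * _).
by case: (rank x s) => [[|j]|] //=; rewrite mulr0.
Qed.

Lemma pair_sumD M (F G : nat -> R) x :
  pair_sum M (fun j => F j + G j) x = pair_sum M F x + pair_sum M G x.
Proof.
rewrite /pair_sum -big_split; apply: eq_bigr => s _.
rewrite -big_split; apply: eq_bigr => i _ /=; rewrite -mulrDr; congr (_ * _).
by case: (rank x s) => [[|j]|] //=; rewrite addr0.
Qed.

Lemma rate_sum_catch_fun M N k x : reachable k x -> (M < N)%N ->
  rate_sum N (fun y => catch_fun M y - catch_fun M x) x =
  \sum_(s <- words M) (x (Some s) == white)%:R *
    (if s is i :: t then
       (if rank x t is Some j.+1 then lam * catch_prob rho j.+2 else 0) else 0).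
Proof.
move=> rx MN; rewrite -(rate_sum_rank_sum (rho := rho) _ rx MN); last first.
  by move=> j; rewrite -(catch_probS j rho0); ring.
rewrite -rate_sum_sum; apply: eq_rate_sum => y; by rewrite -sumrB.
Qed.

(** For the present red vertices the chance to turn blue is a martingale; births
of red vertices only add to it. *)
Lemma catch_fun_sub M N k x : reachable k x -> (M < N)%N -> (k < N)%N ->
  catch_fun M x <= kernel N (catch_fun M) x.
Proof.
move=> rx MN kN; rewrite (kernelE lam0 rho0 _ rx kN) lerDl.
rewrite mulr_ge0 ?invr_ge0 ?tot_rate_ge0// (rate_sum_catch_fun rx MN).
apply: sumr_ge0 => -[|i s] _; rewrite ?mulr0// mulr_ge0//.
by case: (rank x s) => [[|j]|] //; rewrite mulr_ge0 ?ltW ?catch_prob_gt0.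
Qed.

Lemma nblue_le_catch M x : nblue M x <= catch_fun M x.
Proof.
apply: ler_sum => s _; case: eqP => [/rank_blue ->|_].
  by rewrite /= /catch_prob big_ord0.
by case: (rank x s) => //= j; rewrite ltW// catch_prob_gt0.
Qed.

Lemma nblue_mono M M' x : (M <= M')%N -> nblue M x <= nblue M' x.
Proof.
by move=> MM'; apply: sum_words_le => // s; case: (_ == _).
Qed.

(** The sum of [catch_fun] and [pairs_fun] is a supermartingale: the births that
let [catch_fun] grow are paid by the surplus in [subcritical]. *)
Lemma subcritical_nblue_bounded : subcritical d%:R lam rho ->
  exists C, forall M n N, (maxn M n.+1 < N)%N ->
    iter n (kernel N) (nblue M) x0 <= C.
Proof.
move=> [w [wge0 w0 wd]].
exists (catch_prob rho 1 + d%:R * w 1%N) => M n N MN.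
pose M1 := maxn M n.+1; have rx0 := @ced_init_reachable R d.
have nM1 : (n < M1)%N by rewrite leq_max leqnn orbT.
rewrite -(catch_fun_init M1) -(pairs_fun_init M1).
apply: (@le_trans _ _ (iter n (kernel N)
    (fun y => catch_fun M1 y + pairs_fun M1 w y) x0)).
  apply: (iter_kernel_le lam0 rho0 N rx0) => y _.
  rewrite -[leLHS]addr0 lerD ?pairs_fun_ge0//.
  by apply: le_trans (nblue_mono y (leq_maxl M n.+1)) (nblue_le_catch _ _).
apply: (iter_kernel_super lam0 rho0 rx0) => i y ni.
rewrite add0n => ry; have iM := ltn_trans ni nM1.
rewrite (kernelE lam0 rho0 _ ry (ltn_trans iM MN)) gerDl mulr_le0_ge0//;
  last by rewrite invr_ge0 tot_rate_ge0.
have -> : rate_sum N (fun z => catch_fun M1 z + pairs_fun M1 w z -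
      (catch_fun M1 y + pairs_fun M1 w y)) y =
    rate_sum N (fun z => catch_fun M1 z - catch_fun M1 y) y +
    rate_sum N (fun z => pairs_fun M1 w z - pairs_fun M1 w y) y.
  rewrite -rate_sumD.
  by apply: eq_rate_sum => z; ring.
rewrite (rate_sum_catch_fun ry MN) (rate_sum_pairs_fun ry)// ?iM//.
rewrite (sum_white_children (fun j => lam * catch_prob rho j.+1) ry iM).
rewrite -pair_sumD; apply: pair_sum_le0 => j; apply: le_trans (wd j).
rewrite addrC lerD2l -[leRHS]mulr1 ler_pM2l//; exact: catch_prob_le1.
Qed.

(** At step [n] the expectation of [pairs_fun] is at least its initial value
[d%:R * w 1], and [pairs_fun / (C * d%:R)] is at most the expected number of blue
vertices that the present red ones yield in the future. By a step [m] at which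
no vertex of [words M] is likely to be red, this future has happened. *)
Lemma at_least_critical_nblue_gap : at_least_critical d%:R lam rho ->
  exists2 c0, 0 < c0 & forall M n e, (n < M)%N -> 0 < e ->
    exists m N, [/\ (n <= m)%N, (m < N)%N, (M < N)%N &
      iter n (kernel N) (nblue M) x0 + c0 <= iter m (kernel N) (nblue M) x0 + e].
Proof.
move=> [w [C [w0 wpos wd wC]]].
have wge0 j : 0 <= w j by case: j => [|j]; rewrite ?w0// ltW.
have C0 : 0 < C.
  by have := lt_le_trans (wpos 0%N) (wC 1%N); rewrite pmulr_lgt0 ?catch_prob_gt0.
have dR : 0 < d%:R :> R by rewrite ltr0n.
exists (w 1%N / C); first by rewrite divr_gt0.
move=> M n e nM e0.
have [a a0 sa] : exists2 a : R, 0 < a & (size (words (d := d) M))%:R <= a.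
  by exists ((size (words (d := d) M))%:R + 1); rewrite ?lerDl// ltr_wpDl.
have [m [N [nm mN MN alive_lt]]] :=
  eventually_not_alive (d := d) lam0 rho0 M n (divr_gt0 e0 a0).
exists m, N; split=> //; first exact: ltnW.
have rx0 := @ced_init_reachable R d.
pose b := (C * d%:R)^-1; have b0 : 0 < b by rewrite invr_gt0 mulr_gt0.
apply: (@le_trans _ _ (iter n (kernel N)
    (fun y => 1 * nblue M y + b * pairs_fun M w y) x0)).
  rewrite iter_kernel_linear mul1r lerD2l.
  have -> : w 1%N / C = b * pairs_fun M w x0.
    by rewrite pairs_fun_init /b; field; rewrite !gt_eqF.
  rewrite ler_pM2l//; apply: (iter_kernel_sub lam0 rho0 rx0) => i y ni.
  rewrite add0n => ry; have iM := ltn_trans ni nM.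
  rewrite (kernelE lam0 rho0 _ ry (ltn_trans iM MN)) lerDl.
  rewrite mulr_ge0 ?invr_ge0 ?tot_rate_ge0// (rate_sum_pairs_fun ry)// ?iM//.
  exact: pair_sum_ge0.
apply: (@le_trans _ _ (iter n (kernel N) (catch_fun M) x0)).
  apply: (iter_kernel_le lam0 rho0 N rx0) => y _; rewrite mul1r.
  rewrite /nblue /pairs_fun /catch_fun mulr_sumr -big_split.
  apply: ler_sum => s _ /=.
  case rE : (rank y s) => [[|j]|] /=.
  - rewrite (rank0 rE) color_eqE /catch_prob big_ord0 big1 ?mulr0 ?addr0//.
    by move=> i _; rewrite /pair_wt rE /= w0 mulr0.
  - rewrite (rankS rE) color_eqE add0r.
    apply: (@le_trans _ _ (b * \sum_(i < d) C * catch_prob rho j.+1)).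
      rewrite ler_pM2l//; apply: ler_sum => i _; rewrite /pair_wt rE /=.
      case: (_ == white); rewrite ?mul1r// mul0r mulr_ge0 ?ltW//.
      exact: catch_prob_gt0.
    rewrite sumr_const card_ord -mulr_natr le_eqVlt; apply/orP; left.
    by apply/eqP; rewrite /b; field; rewrite !gt_eqF.
  - rewrite big1 ?mulr0 ?addr0; last by move=> i _; rewrite /pair_wt rE mulr0.
    by case: eqP => // /rank_blue; rewrite rE.
apply: (@le_trans _ _ (iter m (kernel N) (catch_fun M) x0)).
  apply: (iter_kernel_sub_le lam0 rho0 rx0 nm) => i y im; rewrite add0n => ry.
  by apply: (catch_fun_sub ry MN); rewrite (ltn_trans im)// ltnW.
apply: (@le_trans _ _ (iter m (kernel N)
    (fun y => 1 * nblue M y + a * (alive M y)%:R) x0)).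
  apply: (iter_kernel_le lam0 rho0 N rx0) => y _; rewrite mul1r.
  apply: (@le_trans _ _ (nblue M y + \sum_(s <- words M) (alive M y)%:R)).
    rewrite /nblue /catch_fun -[leRHS]big_split big_seq [leRHS]big_seq.
    apply: ler_sum => s sM /=; case rE : (rank y s) => [[|j]|] /=.
    - rewrite (rank0 rE) color_eqE /catch_prob big_ord0 lerDl//.
    - have -> : alive M y by apply/hasP; exists s => //; rewrite (rankS rE).
      by apply: le_trans (catch_prob_le1 _ rho0) _; rewrite lerDr.
    - by rewrite addr_ge0.
  rewrite lerD2l big_const_seq count_predT iter_addr_0 -[_ *+ size _]mulr_natl.
  apply: ler_wpM2r; [exact: ler0n | exact: sa].
rewrite (iter_kernel_linear _ _ _ _ _ _ _ (fun y => (alive M y)%:R)) mul1r lerD2l.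
by rewrite mulrC -ler_pdivlMr//; exact: ltW.
Qed.

Lemma rankS_frontier x s j : x None = blue -> rank x s = Some j.+1 ->
  exists2 u, x (Some u) = red & x (par u) = blue.
Proof.
move=> xN; elim: s j => [|i s IH] j rE; first by exists [::] => //; exact: rankS rE.
have xr := rankS rE; move: rE; rewrite /= xr.
case rE : (rank x s) => [[|j']|] //= _; last exact: IH rE.
by exists (i :: s) => //; exact: rank0.
Qed.

Lemma notblue_below k x u q : reachable k x -> x (Some u) <> blue ->
  x (Some (q ++ u)) <> blue.
Proof. by move=> rx xu; elim: q => //= i q IH /(reach_blue rx). Qed.

(** Only red vertices lie between a vertex and the blue front above it. *)
Lemma rank_deep y q u j :
  (forall p, p != [::] -> y (Some (p ++ u)) <> blue) ->
  rank y (q ++ u) = Some j -> (size q <= j)%N.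
Proof.
move=> yb; elim: q j => //= i q IH j.
have := yb (i :: q) isT; rewrite /=.
case: (y _) => // _; case rE : (rank y (q ++ u)) => [j'|] //= [<-].
exact: IH rE.
Qed.

(** The weight of a pair, indexed by its child. *)
Definition child_wt (w : nat -> R) y t : R :=
  if t is i :: s then pair_wt w i s y else 0.

Lemma pairs_fun_child M w y :
  pairs_fun M w y = \sum_(t <- words M.+1) child_wt w y t.
Proof. by rewrite big_words add0r /pairs_fun exchange_big. Qed.

Section Jump.
Variables (w : nat -> R) (J : nat).
Hypotheses (w0 : w 0%N = 0) (wge0 : forall j, 0 <= w j).
Hypothesis wJ : forall j, (J < j)%N -> w j = 0.

(** The move at [u] affects the rank of a vertex far below [u] only by changing a
rank that is too large for its weight not to vanish. *)
Lemma child_wt_far k x u c t : reachable k x -> rate x u c != 0 ->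
  (forall p, (size p <= J.+1)%N -> t <> p ++ u) ->
  child_wt w (recolor x (Some u) c) t = child_wt w x t.
Proof.
move=> rx rc far; case: t far => // i s far.
have tu : i :: s != u by apply/eqP; exact: (far [::]).
rewrite /= /pair_wt (recolor_other _ _ tu); congr (_ * _).
have [[p sE]|sp] := pselect (exists p, s = p ++ u); last first.
  by rewrite rank_recolor_out// => p e; apply: sp; exists p.
have pJ : (J < size p)%N.
  by rewrite ltnNge; apply/negP => pJ; apply: (far (i :: p)) => //=; rewrite sE.
have wt0 y : (forall p, p != [::] -> y (Some (p ++ u)) <> blue) ->
    wt w (rank y s) = 0.
  move=> yb; case rE : (rank y s) => [j|] //=; apply: wJ.
  by apply: leq_trans pJ _; apply: rank_deep yb _; rewrite -sE.
have xb q : x (Some (q ++ u)) <> blue by apply: notblue_below rx (rate_not_blue rc).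
rewrite !wt0// => q q0; rewrite recolor_other//.
apply: contraNneq q0 => /(congr1 size)/eqP.
by rewrite size_cat -[X in _ == X]add0n eqn_add2r size_eq0.
Qed.

Lemma wt_bounded : exists2 B, 0 < B & forall o, wt w o <= B.
Proof.
have [|B wB] := @bounded_above_from _ w J.+1 0; first by move=> j /wJ ->.
exists (Num.max B 1); first by rewrite lt_max ltr01 orbT.
by case=> [j|] /=; rewrite le_max ?wB// ler01 orbT.
Qed.

(** A move affects only pairs within bounded distance below it, and the number of
these does not depend on the state. *)
Lemma pairs_fun_jump : exists2 B, 0 < B & forall M k x u c, reachable k x ->
  rate x u c != 0 ->
  `|pairs_fun M w (recolor x (Some u) c) - pairs_fun M w x| <= B.
Proof.
have [B B0 wB] := wt_bounded.
pose near u := [seq p ++ u | p <- words J.+1 : seq word].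
pose S : R := (size (words (d := d) J.+1))%:R.
have S0 : 0 < S by rewrite ltr0n; case: (J).
exists (B * S); first by rewrite mulr_gt0.
move=> M k x u c rx rc; rewrite !pairs_fun_child -sumrB.
apply: le_trans (ler_norm_sum _ _ _) _.
have cB y t : 0 <= child_wt w y t <= B.
  case: t => [|i s] /=; first by rewrite lexx ltW.
  rewrite /pair_wt; case: eqP => _; last by rewrite mul0r lexx ltW.
  by rewrite mul1r wB andbT; case: (rank y s) => //=.
apply: (@le_trans _ _ (\sum_(t <- words M.+1) B * (t \in near u)%:R)).
  apply: ler_sum => t _; case: (boolP (t \in near u)) => [_|tn].
    have /andP[a1 a2] := cB (recolor x (Some u) c) t; have /andP[b1 b2] := cB x t.
    by rewrite mulr1 ler_norml; apply/andP; split; lra.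
  rewrite (child_wt_far rx rc) ?subrr ?normr0 ?mulr0// => p pJ tE.
  by move/negP: tn; apply; apply/mapP; exists p; rewrite ?mem_words.
rewrite -mulr_sumr ler_pM2l// -natr_sum ler_nat.
have -> : (\sum_(t <- words M.+1) (t \in near u) = count (mem (near u)) (words M.+1))%N.
  by rewrite -sum1_count [RHS]big_mkcond; apply: eq_bigr => t _ /=; case: (t \in _).
rewrite -size_filter -(size_map (fun p => p ++ u)).
apply: uniq_leq_size; first exact/filter_uniq/words_uniq.
by move=> t; rewrite mem_filter => /andP[].
Qed.
End Jump.

Definition deep L x : Prop := exists2 s, (L <= size s)%N & x (Some s) = blue.

(** The function [c / (c + h)], where [h] is [pairs_fun], is a supermartingale: its
first order change is given by the drift of [h], and as the jumps of [h] are at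
most [B = kappa * c], the second order term is at most [kappa] times the rate of
absolute change. Hence [h] does not vanish with a probability bounded away from
0. Once no vertex of [words L] is red, [h > 0] requires a blue vertex at depth at
least [L]. *)
Lemma supercritical_deep : supercritical d%:R lam rho ->
  exists2 c0, 0 < c0 & forall L, exists n N, (n < N)%N /\
    c0 <= iter n (kernel N) (fun y => `[< deep L y >]%:R) x0.
Proof.
move=> [w [kappa [J [kappa0 [w0 w1] wge0 wJ wd]]]].
have [B B0 jump] := pairs_fun_jump wge0 wJ.
pose c := B / kappa; have c0 : 0 < c by rewrite divr_gt0.
have dR : 0 < d%:R :> R by rewrite ltr0n.
have rx0 := @ced_init_reachable R d.
pose a : R := d%:R * w 1%N; have a0 : 0 < a by rewrite mulr_gt0.
have ca : 0 < c + a by rewrite addr_gt0.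
exists (a / (c + a) / 2); first by rewrite !divr_gt0.
move=> L; have [n [N [_ nN LN dead_lt]]] :=
  eventually_not_alive (d := d) lam0 rho0 L 0 (divr_gt0 (divr_gt0 a0 ca) (ltr0Sn R 1)).
exists n, N; split; first exact: ltnW.
pose M := N.-1; have NM : N = M.+1 by rewrite prednK// (leq_ltn_trans _ nN).
have nM : (n < M)%N by rewrite NM in nN.
pose h := pairs_fun M w.
have h0 y : 0 <= h y by exact: pairs_fun_ge0.
pose F y := c / (c + h y).
have ch y : 0 < c + h y by rewrite ltr_pwDl.
have F0 y : 0 <= F y by rewrite divr_ge0 ?ltW.
have Fsuper i y : (i < n)%N -> reachable (0 + i) y -> kernel N F y <= F y.
  rewrite add0n => ni ry; have iM := ltn_trans ni nM.
  have iN : (i < N)%N by rewrite NM ltnW.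
  rewrite (kernelE lam0 rho0 _ ry iN) gerDl mulr_le0_ge0//;
    last by rewrite invr_ge0 tot_rate_ge0.
  pose q := c / (c + h y) ^+ 2.
  have q0 : 0 < q by rewrite divr_gt0// exprn_gt0.
  apply: (@le_trans _ _ (rate_sum N (fun z => (- q) * (h z - h y) +
      (q * kappa) * `|h z - h y|) y)).
    apply: rate_sum_le => // s e rse; have := jump M _ _ _ _ ry rse.
    rewrite -/(h _) -/(h y); move: (recolor y (Some s) e) => z.
    set D := h z - h y => DB.
    have hz : h z = h y + D by rewrite /D addrC subrK.
    have hp := ch z; rewrite /F hz in hp *.
    have -> : c / (c + (h y + D)) - c / (c + h y) =
       q * (- D + D ^+ 2 / (c + (h y + D))).
      by rewrite /q; field; rewrite !gt_eqF.
    have -> : - q * D + q * kappa * `|D| = q * (- D + kappa * `|D|) by ring.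
    rewrite ler_pM2l// lerD2l ler_pdivrMr//.
    have Dn : D ^+ 2 = `|D| * `|D| by rewrite -expr2 real_normK// num_real.
    have cz : c <= c + (h y + D) by rewrite lerDl -hz.
    apply: (@le_trans _ _ (`|D| * B)); first by rewrite Dn ler_wpM2l.
    have -> : `|D| * B = kappa * `|D| * c by rewrite /c; field; rewrite gt_eqF.
    by rewrite ler_wpM2l// mulr_ge0// ltW.
  rewrite (rate_sum_linear _ _ _ _ _ (fun z => h z - h y) (fun z => `|h z - h y|)).
  set A1 := rate_sum N _ y; set A2 := rate_sum N _ y.
  have -> : - q * A1 + q * kappa * A2 = q * (kappa * A2 - A1) by ring.
  rewrite pmulr_rle0// subr_le0 {}/A1 {}/A2.
  have kMN : (i < M < N)%N by rewrite iM NM leqnn.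
  rewrite (rate_sum_pairs_fun ry kMN w0).
  apply: (@le_trans _ _ (pair_sum M
      (fun j => kappa * turnover d%:R lam rho w j) y)); last exact: pair_sum_le.
  rewrite pair_sumZ ler_pM2l//; exact: rate_sum_pairs_fun_abs ry kMN w0 wge0.
have EF : iter n (kernel N) F x0 <= c / (c + a).
  by apply: le_trans (iter_kernel_super lam0 rho0 rx0 Fsuper) _; rewrite /F /h pairs_fun_init.
have E1 : 1 - c / (c + a) <= iter n (kernel N) (fun y => 1 * 1 + (-1) * F y) x0.
  rewrite (iter_kernel_linear _ _ _ _ _ _ (fun=> 1)) (iter_kernel_cst lam0 rho0 _ rx0);
    last by rewrite add0n ltnW// ltnW.
  by rewrite !mul1r mulN1r lerD2l lerN2.
have E2 : iter n (kernel N) (fun y => 1 * 1 + (-1) * F y) x0 <=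
    iter n (kernel N) (fun y => 1 * (alive L y)%:R + 1 * `[< deep L y >]%:R) x0.
  apply: (iter_kernel_le lam0 rho0 N rx0) => y; rewrite add0n => ry.
  rewrite !mul1r mulN1r.
  have F1 : 1 - F y <= 1 by rewrite lerBlDr lerDl.
  have [al|nal] := boolP (alive L y); first by apply: le_trans F1 _; rewrite lerDl.
  case: asboolP => [|ndeep]; first by rewrite add0r.
  suff hy : h y = 0 by rewrite /F hy addr0 divff ?gt_eqF// subrr addr0.
  apply: big1 => s _; apply: big1 => i _; rewrite /pair_wt.
  case rE : (rank y s) => [[|j]|] /=; rewrite ?w0 ?mulr0//.
  have [u yu yp] := rankS_frontier (reach_extra ry) rE; exfalso.
  have Lu : (L < size u)%N.
    rewrite ltnNge; apply: contra nal => uL; apply/hasP; exists u.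
      by rewrite mem_words.
    by rewrite yu.
  case: u yu yp Lu => // e u yu yp Lu; apply: ndeep; exists u => //.
have := le_trans E1 E2.
rewrite (iter_kernel_linear _ _ _ _ _ _ (fun y => (alive L y)%:R)
  (fun y => `[< deep L y >]%:R)) !mul1r.
have -> : 1 - c / (c + a) = a / (c + a) by field; rewrite gt_eqF.
lra.
Qed.

End Functionals.

(** * From the jump chain to the process *)

Section JumpChain.
Context {R : realType} {d : nat}.
Variables (lam rho : R).
Hypotheses (lam0 : 0 < lam) (rho0 : 0 < rho).
Local Notation state := (vertex d -> color).
Local Notation kernel := (@kernel R d lam rho).
Local Notation succ := (@succ R d lam rho).
Local Notation reachable := (@reachable R d).
Local Notation Q := (ced_rate (@tree_adj d) lam rho).
Local Notation x0 := (@ced_init d).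
Implicit Types (x y : state) (p : seq state) (n N k : nat).

Fixpoint paths N n x : seq (seq state) :=
  if n is n'.+1 then flatten [seq [seq y :: p | p <- paths N n' y] | y <- succ N x]
  else [:: [::]].

Fixpoint weight x p : R :=
  if p is y :: p' then jump_prob Q x y * weight y p' else 1.

Lemma sum_paths N n f x :
  \sum_(p <- paths N n x) weight x p * f (last x p) = iter n (kernel N) f x.
Proof.
elim: n x => [|n IH] x; first by rewrite /= big_seq1 mul1r.
rewrite iterS /= big_flatten big_map /kernel; apply: eq_bigr => y _.
by rewrite big_map -IH mulr_sumr; apply: eq_bigr => p _; rewrite /= mulrA.
Qed.

Lemma mem_pathsS N n x y p : (y :: p \in paths N n.+1 x) =
  (y \in succ N x) && (p \in paths N n y).
Proof.
apply/flatten_mapP/andP => [[z zs /mapP[q qp [-> ->]]]|[ys pp]] //.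
by exists y => //; apply/mapP; exists p.
Qed.

Lemma size_paths N n x p : p \in paths N n x -> size p = n.
Proof.
elim: n x p => [|n IH] x p; first by rewrite inE => /eqP ->.
case: p => [|y p]; first by move=> /flatten_mapP[z _ /mapP[]].
by rewrite mem_pathsS => /andP[_ /IH /= ->].
Qed.

Lemma succ_uniq N x : uniq (succ N x).
Proof. by rewrite /succ; case: ifP => // _; exact: moved_uniq. Qed.

Lemma paths_uniq N n x : uniq (paths N n x).
Proof.
elim: n x => //= n IH x; elim: (succ N x) (succ_uniq N x) => //= y r IHr.
move=> /andP[yr ur]; rewrite cat_uniq IHr// andbT map_inj_uniq ?IH//=; last first.
  by move=> p q [].
apply/hasPn => q /flatten_mapP[z zr /mapP[q' _ ->]]; apply/negP => /mapP[p _ [zy _]].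
by move: yr; rewrite -zy zr.
Qed.

Lemma paths_nth N n k x p i : reachable k x -> p \in paths N n x -> (i < n)%N ->
  reachable (k + i) (nth x0 (x :: p) i) /\
  nth x0 (x :: p) i.+1 \in succ N (nth x0 (x :: p) i).
Proof.
elim: n k x p i => // n IH k x [|y p] i rx.
  by move=> /size_paths.
rewrite mem_pathsS => /andP[ys pp]; case: i => [|i] ni.
  by rewrite addn0 /= ys.
have ry := reachable_succ rx ys.
by have := IH k.+1 y p i ry pp ni; rewrite addSnnS.
Qed.

Lemma weightE x p :
  weight x p = \prod_(k < size p) jump_prob Q (nth x0 (x :: p) k) (nth x0 (x :: p) k.+1).
Proof.
elim: p x => [|y p IH] x; first by rewrite big_ord0.
by rewrite /= big_ord_recl /= IH.
Qed.

Lemma succ_blue N x y v : y \in succ N x -> x v = blue -> y v = blue.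
Proof.
rewrite /succ; case: ifP => _; first by rewrite inE => /eqP ->.
move=> /mapP[[s c] /mem_moves/= rc ->] xv; rewrite /recolor; case: eqP => // e.
by case: (rate_not_blue rc); rewrite -e.
Qed.

Lemma succ_absorbed N k x y : reachable k x -> (k < N)%N -> total_rate Q x = 0 ->
  y \in succ N x -> y = x.
Proof.
move=> rx kN; rewrite (total_rateE lam0 rho0 rx kN) => t0.
by rewrite /succ t0 eqxx inE => /eqP.
Qed.

Section Process.
Context {disp : measure_display} {T : measurableType disp} (P : probability T R).
Variables (X : R -> T -> state) (Y : nat -> T -> state) (S : nat -> T -> \bar R).
Hypothesis mY : forall n v c, measurable [set w | Y n w v = c].
Hypothesis mS : forall n, measurable_fun setT (S n) /\ forall w, (0 < S n w)%E.
Hypothesis law : forall (n : nat) (y : nat -> state) (t : nat -> R),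
  (forall k, 0 <= t k) ->
  P [set w | (forall k, (k < n)%N -> Y k w = y k /\ ((t k)%:E < S k w)%E)
             /\ Y n w = y n]
  = ((y 0%N == x0)%:R *
     \prod_(k < n) (jump_prob Q (y k) (y k.+1) *
                    expR (- (total_rate Q (y k) * t k))))%:E.
Hypothesis clock : forall w t, 0 <= t -> exists n,
  (jump_time S n w <= t%:E < jump_time S n.+1 w)%E /\ X t w = Y n w.

Local Open Scope ereal_scope.

Lemma measurable_state n x : measurable [set w | Y n w = x].
Proof.
have -> : [set w | Y n w = x] = \bigcap_(v in setT) [set w | Y n w v = x v].
  apply/seteqP; split=> w /=; first by move=> e v _; rewrite /= e.
  by move=> h; apply/funext => v; exact: h.
rewrite -[X in measurable X]setCK setC_bigcap; apply: measurableC.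
apply: countable_bigcupT_measurable; first exact: countableP.
by move=> v; apply: measurableC; exact: mY.
Qed.

Definition follows p : set T :=
  [set w | forall k, (k <= size p)%N -> Y k w = nth x0 (x0 :: p) k].

Lemma measurable_follows p : measurable (follows p).
Proof.
have -> : follows p =
    \bigcap_(k in [set k | (k <= size p)%N]) [set w | Y k w = nth x0 (x0 :: p) k].
  by [].
by apply: bigcap_measurable => [|k _]; [exists 0%N | exact: measurable_state].
Qed.

Lemma prob_follows p : P (follows p) = (weight x0 p)%:E.
Proof.
have := @law (size p) (nth x0 (x0 :: p)) (fun=> 0%R) (fun=> lexx _).
rewrite /= eqxx mul1r weightE.
rewrite (eq_bigr (fun k : 'I_(size p) =>
   jump_prob Q (nth x0 (x0 :: p) k) (nth x0 (x0 :: p) k.+1))); last first.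
  by move=> k _; rewrite mulr0 oppr0 expR0 mulr1.
move=> <-; congr (P _); apply/seteqP; split=> w /= h.
  by split=> [k kp|]; [split; [apply: h; exact: ltnW|exact: (mS k).2] | exact: h].
move=> k; rewrite leq_eqVlt => /orP[/eqP ->|kp]; first exact: h.2.
by have [] := h.1 _ kp.
Qed.

Lemma measurable_stuck i : measurable [set w | S i w = +oo].
Proof.
rewrite -[X in measurable X]setTI.
have -> : [set w | S i w = +oo] = [set w | +oo <= S i w].
  by apply/seteqP; split=> w /=; rewrite leye_eq => /eqP.
exact: emeasurable_fun_c_infty (mS i).1 _.
Qed.

(** The law of the process with threshold [m] for the [i]-th holding time bounds
this probability by [expR (- (r * m))], for every [m]. *)
Lemma prob_follows_stuck p i : (i < size p)%N ->
  total_rate Q (nth x0 (x0 :: p) i) != 0%R ->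
  P (follows p `&` [set w | S i w = +oo]) = 0.
Proof.
move=> ip r0; set r := total_rate _ _ in r0.
have rge0 : (0 <= r)%R by apply: fsumr_ge0 => z _; exact: ced_rate_ge0.
have rgt0 : (0 < r)%R by rewrite lt_def r0.
have mE : measurable (follows p `&` [set w | S i w = +oo]).
  by apply: measurableI; [exact: measurable_follows | exact: measurable_stuck].
apply/eqP; rewrite eq_le measure_ge0 andbT; apply/lee_addgt0Pr => e e0.
rewrite add0e.
(* For this [m], [1 + r * m.+1 >= 1 / e]. *)
pose m := Num.truncn (r * e)^-1.
pose t k : R := if k == i then (m.+1)%:R else 0%R.
have t0 k : (0 <= t k)%R by rewrite /t; case: ifP.
have := @law (size p) (nth x0 (x0 :: p)) t t0.
set L := [set w | _]; rewrite /= eqxx mul1r big_split /= -weightE => PL.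
have mL : measurable L.
  have -> : L = (\bigcap_(k in [set k | (k < size p)%N])
     ([set w | Y k w = nth x0 (x0 :: p) k] `&` [set w | (t k)%:E < S k w]))
       `&` [set w | Y (size p) w = nth x0 (x0 :: p) (size p)] by [].
  apply: measurableI; last exact: measurable_state.
  apply: bigcap_measurable => [|k _]; first by exists i.
  apply: measurableI; first exact: measurable_state.
  rewrite -[X in measurable X]setTI; exact: emeasurable_fun_o_infty (mS k).1 _.
apply: (@le_trans _ _ (P L)).
  apply: le_measure; rewrite ?inE// => w [fw /= Sw]; split; last exact: fw.
  move=> k kp; split; first by apply: fw; exact: ltnW.
  rewrite /t; case: eqP => [->|_]; first by rewrite Sw ltry.
  exact: (mS k).2.
rewrite PL lee_fin.
have -> : (\prod_(k < size p) expR (- (total_rate Q (nth x0 (x0 :: p) k) * t k)) =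
    expR (- (r * m.+1%:R)))%R.
  rewrite (bigD1 (Ordinal ip))//= big1 ?mulr1; first by rewrite /t eqxx.
  by move=> k ki; rewrite /t ifF ?mulr0 ?oppr0 ?expR0//; exact/negbTE.
have w1 : (weight x0 p <= 1)%R.
  by rewrite -lee_fin -prob_follows; apply: probability_le1; exact: measurable_follows.
apply: (@le_trans _ _ (1 * expR (- (r * m.+1%:R)))%R).
  by rewrite ler_wpM2r// expR_ge0.
rewrite mul1r expRN invf_ple ?posrE ?expR_gt0//.
apply: le_trans (expR_ge1Dx _).
have : ((r * e)^-1 <= m.+1%:R)%R by rewrite ltW// truncnS_gt.
rewrite invfM mulrC ler_pdivrMr// mulrC => h; apply: le_trans h _.
by rewrite lerDr.
Qed.

Definition tracked N n : set T := \bigcup_(p in [set` paths N n x0]) follows p.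

Lemma trivIset_follows N n : trivIset [set` paths N n x0] follows.
Proof.
move=> p q /= pp qp [w [fp fq]]; have sp := size_paths pp; have sq := size_paths qp.
apply: (@eq_from_nth _ x0); first by rewrite sp sq.
move=> i ip; have h1 := fp i.+1 ip; have := fq i.+1; rewrite sq -sp => /(_ ip).
by rewrite h1.
Qed.

Lemma measure_paths N n (E : set T) : measurable E ->
  P (E `&` tracked N n) = \sum_(p <- paths N n x0) P (E `&` follows p).
Proof.
move=> mE; rewrite /tracked setI_bigcupr measure_fin_bigcup//.
- by rewrite -fsbig_seq ?paths_uniq.
- exact: finite_seq.
- move=> p q pp qp [w [[_ fp] [_ fq]]].
  by apply: (trivIset_follows pp qp); exists w.
- by move=> p _; apply: measurableI => //; exact: measurable_follows.
Qed.

Lemma measurable_tracked N n : measurable (tracked N n).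
Proof. apply: fin_bigcup_measurable => [|p _]; [exact: finite_seq | exact: measurable_follows]. Qed.

Lemma prob_tracked N n : (n <= N)%N -> P (tracked N n) = 1.
Proof.
move=> nN; rewrite -[tracked N n]setTI measure_paths//.
under eq_bigr => p _ do rewrite setTI prob_follows.
rewrite sumEFin; congr (_%:E).
rewrite -(iter_kernel_cst lam0 rho0 1 (@ced_init_reachable R d) (nN : (0 + n <= N)%N)).
by rewrite -sum_paths; apply: eq_bigr => p _; rewrite mulr1.
Qed.

Lemma prob_untracked N n : (n <= N)%N -> P (~` tracked N n) = 0.
Proof.
move=> nN; rewrite probability_setC ?prob_tracked ?subee//.
exact: measurable_tracked.
Qed.

(** Almost surely the first [n] jumps follow one of the finitely many [paths]. *)
Lemma prob_chain N n (A : set state) : (n <= N)%N -> measurable [set w | A (Y n w)] ->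
  P [set w | A (Y n w)] = (iter n (kernel N) (fun y => `[< A y >]%:R) x0)%:E.
Proof.
move=> nN mA; rewrite -sum_paths.
have -> : P [set w | A (Y n w)] = P ([set w | A (Y n w)] `&` tracked N n).
  rewrite -[in LHS](setIT [set w | A (Y n w)]) -(setUv (tracked N n)) setIUr.
  rewrite measureU0//.
  - by apply: measurableI => //; exact: measurable_tracked.
  - by apply: measurableI => //; apply: measurableC; exact: measurable_tracked.
  - apply/eqP; rewrite eq_le measure_ge0 andbT.
    rewrite -(prob_untracked nN).
    apply: le_measure; rewrite ?inE; last exact: subIsetr.
      by apply: measurableI => //; apply: measurableC; exact: measurable_tracked.
    by apply: measurableC; exact: measurable_tracked.
rewrite measure_paths// -sumEFin big_seq [RHS]big_seq; apply: eq_bigr => p pp.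
have lastE w : follows p w -> Y n w = last x0 p.
  move=> /(_ n); rewrite (size_paths pp) => -> //.
  by rewrite -(size_paths pp) -[size p]/(size (x0 :: p)).-1 nth_last.
case: asboolP => Al.
  rewrite mulr1 -prob_follows; congr (P _); apply/seteqP; split=> w; first by case.
  by move=> fw; split=> //=; rewrite (lastE w fw).
rewrite mulr0 (_ : _ `&` _ = set0) ?measure0//.
by apply/seteqP; split=> w //= [Aw fw]; apply: Al; rewrite -(lastE w fw).
Qed.

(** Outside this null set the chain only makes moves of positive rate and leaves
every state that is not absorbing. *)
Definition exceptional : set T := \bigcup_n
  (~` tracked n.+1 n `|` \bigcup_(p in [set` paths n.+1 n x0])
     \bigcup_(i in [set i | (i < n)%N /\ total_rate Q (nth x0 (x0 :: p) i) != 0%R])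
        (follows p `&` [set w | S i w = +oo])).

Lemma exceptional_null : P.-negligible exceptional.
Proof.
apply: negligible_bigcup => n; apply: negligibleU.
  exists (~` tracked n.+1 n); split=> //; last exact: prob_untracked.
  by apply: measurableC; exact: measurable_tracked.
rewrite bigcup_seq big_seq; apply: big_ind => [||p pp].
- exact: negligible_set0.
- exact: negligibleU.
rewrite bigcup_mkcond; apply: negligible_bigcup => i.
case: ifPn => [|_]; last exact: negligible_set0.
rewrite inE => -[ni ri]; exists (follows p `&` [set w | S i w = +oo]); split=> //.
  by apply: measurableI; [exact: measurable_follows | exact: measurable_stuck].
by apply: prob_follows_stuck ri; rewrite (size_paths pp).
Qed.

Lemma not_exceptional w n : ~ exceptional w ->
  [/\ reachable n (Y n w), Y n.+1 w \in succ n.+2 (Y n w)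
    & total_rate Q (Y n w) != 0%R -> S n w < +oo].
Proof.
move=> Zw; have [p pp fp] : tracked n.+2 n.+1 w.
  by apply: contrapT => h; apply: Zw; exists n.+1 => //; left.
have pp' : p \in paths n.+2 n.+1 x0 by [].
have [rp sp] := paths_nth (@ced_init_reachable R d) pp' (ltnSn n).
have e1 : Y n w = nth x0 (x0 :: p) n by apply: fp; rewrite (size_paths pp').
have e2 : Y n.+1 w = nth x0 (x0 :: p) n.+1 by apply: fp; rewrite (size_paths pp').
rewrite e1 e2; split=> // r0; rewrite ltey; apply/eqP => Sw; apply: Zw.
exists n.+1 => //; right; exists p => //; exists n => //=; split=> //.
Qed.

Lemma jump_timeS n w : jump_time S n.+1 w = jump_time S n w + S n w.
Proof. by rewrite /jump_time big_ord_recr. Qed.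

Lemma jump_time_ge0 n w : 0 <= jump_time S n w.
Proof. by apply: sume_ge0 => i _; apply: ltW; exact: (mS i).2. Qed.

Lemma jump_time_le n m w : (n <= m)%N -> jump_time S n w <= jump_time S m w.
Proof.
move=> /subnK <-; elim: (m - n)%N => // k IH; apply: le_trans IH _.
by rewrite addSn jump_timeS leeDl//; apply: ltW; exact: (mS _).2.
Qed.

Lemma jump_time_lt n w : jump_time S n w < +oo ->
  jump_time S n w < jump_time S n.+1 w.
Proof.
move=> Tn; have Tfin : jump_time S n w \is a fin_num.
  by rewrite ge0_fin_numE// jump_time_ge0.
by rewrite jump_timeS lteDl//; exact: (mS n).2.
Qed.

(** The process visits the [n]-th state of the chain exactly if the time of its
entrance is finite. *)
Lemma ever_blueE w v :
  ever_blue X w v <-> exists2 n, Y n w v = blue & jump_time S n w < +oo.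
Proof.
split=> [[t t0 Xt]|[n Yn Tn]].
  have [n [/andP[h _] XY]] := clock w t0; exists n; first by rewrite -XY.
  exact: le_lt_trans h (ltry _).
have Tfin : jump_time S n w \is a fin_num by rewrite ge0_fin_numE// jump_time_ge0.
have t0 : (0 <= fine (jump_time S n w))%R by rewrite fine_ge0// jump_time_ge0.
exists (fine (jump_time S n w)) => //.
have [m [/andP[h1 h2] ->]] := clock w t0; rewrite fineK// in h1 h2.
suff -> : m = n by [].
apply/eqP; rewrite eqn_leq; apply/andP; split; rewrite leqNgt; apply/negP => mn.
  have := lt_le_trans (jump_time_lt Tn) (le_trans (jump_time_le w mn) h1).
  by rewrite ltxx.
by have := lt_le_trans h2 (jump_time_le w mn); rewrite ltxx.
Qed.

Lemma measurable_jump_time n : measurable [set w | jump_time S n w < +oo].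
Proof.
rewrite -[X in measurable X]setTI; apply: emeasurable_fun_infty_o => //.
by apply: emeasurable_sum => i; exact: (mS i).1.
Qed.

Lemma measurable_ever_blue v : measurable [set w | ever_blue X w v].
Proof.
have -> : [set w | ever_blue X w v] =
    \bigcup_n ([set w | Y n w v = blue] `&` [set w | jump_time S n w < +oo]).
  apply/seteqP; split=> w /=.
    by move=> /ever_blueE[n Yn Tn]; exists n.
  by move=> [n _ [Yn Tn]]; apply/ever_blueE; exists n.
apply: bigcupT_measurable => n; apply: measurableI; first exact: mY.
exact: measurable_jump_time.
Qed.

Lemma blue_persists w n v : ~ exceptional w -> Y n w v = blue ->
  Y n.+1 w v = blue.
Proof.
by move=> /(not_exceptional n)[_ sY _]; exact: succ_blue sY.
Qed.

(** No state before the first one in which [v] is blue is absorbing, hence this one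
is entered at a finite time. *)
Lemma blue_ever_blue w n v : ~ exceptional w -> Y n w v = blue -> ever_blue X w v.
Proof.
move=> Zw Yn; apply/ever_blueE.
have [k Yk kmin] := @ex_minnP (fun k => `[< Y k w v = blue >])
  (ex_intro _ n (asboolT Yn)).
move/asboolP: Yk => Yk; exists k => //.
have moving i : (i < k)%N -> total_rate Q (Y i w) != 0%R.
  move=> ik; apply/eqP => r0.
  have YE j : Y (i + j)%N w = Y i w.
    elim: j => [|j IH]; first by rewrite addn0.
    have [rj sj _] := not_exceptional (i + j)%N Zw; rewrite addnS.
    by rewrite (succ_absorbed rj _ _ sj) ?IH.
  have := kmin i; rewrite leqNgt ik => /(_ _)/negP; case=> //; apply/asboolP.
  by rewrite -(YE (k - i)%N) subnKC// ltnW.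
apply: lte_sum_pinfty => -[i ik] _ /=.
by have [_ _] := not_exceptional i Zw; apply; exact: moving.
Qed.

Lemma prob_setD_null (E Z : set T) : measurable E -> measurable Z -> P Z = 0 ->
  P (E `\` Z) = P E.
Proof.
move=> mE mZ PZ; transitivity (P E - P (E `&` Z)).
  by apply: measureD => //; exact: le_lt_trans (probability_le1 P mE) (ltry _).
rewrite (_ : P (E `&` Z) = 0) ?sube0//.
apply/eqP; rewrite eq_le measure_ge0 andbT -PZ le_measure ?inE//.
exact: measurableI.
Qed.

Lemma prob_blue_le n v :
  P [set w | Y n w v = blue] <= P [set w | ever_blue X w v].
Proof.
have [Z [mZ PZ ZZ]] := exceptional_null.
rewrite -(prob_setD_null (mY n v blue) mZ PZ); apply: le_measure; rewrite ?inE.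
- by apply: measurableD => //; exact: mY.
- exact: measurable_ever_blue.
- by move=> w [Yn Zw]; apply: blue_ever_blue Yn => /ZZ.
Qed.

(** Up to a null set the events on the left increase to the one on the right. *)
Lemma prob_blue_cvg v :
  P [set w | Y n w v = blue] @[n --> \oo] --> P [set w | ever_blue X w v].
Proof.
have [Z [mZ PZ ZZ]] := exceptional_null.
pose B n := [set w | Y n w v = blue] `\` Z.
have mB n : measurable (B n) by apply: measurableD => //; exact: mY.
have PD E (mE : measurable E) := prob_setD_null mE mZ PZ.
have BE : \bigcup_n B n = [set w | ever_blue X w v] `\` Z.
  apply/seteqP; split=> w.
    move=> [n _ [Yn Zw]]; split=> //; apply: blue_ever_blue Yn.
    by move=> /ZZ.
  by move=> [/ever_blueE[n Yn _] Zw]; exists n.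
rewrite -(PD _ (measurable_ever_blue v)) -BE.
have -> : (fun n => P [set w | Y n w v = blue]) = P \o B.
  by apply/funext => n /=; rewrite PD//; exact: mY.
apply: nondecreasing_cvg_mu => //; first exact: bigcupT_measurable.
apply/nondecreasing_seqP => n; apply/subsetPset => w [Yn Zw]; split=> //.
by apply: blue_persists Yn => /ZZ.
Qed.

End Process.
End JumpChain.

(** * The number of blue vertices *)

Section Counting.
Context {R : realType} {d : nat}.
Implicit Types (A : set (vertex d)) (M : nat).
Local Open Scope ereal_scope.

Definition depth (v : vertex d) : nat := if v is Some s then size s else 0%N.

Definition verts M : seq (vertex d) := None :: [seq Some s | s <- words M].

Lemma mem_verts M v : (v \in verts M) = (depth v <= M)%N.
Proof.
case: v => [s|]; last by rewrite inE eqxx.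
by rewrite inE /= mem_map ?mem_words// => x y [].
Qed.

Lemma verts_uniq M : uniq (verts M).
Proof.
rewrite /= map_inj_uniq ?words_uniq ?andbT; last by move=> x y [].
by apply/mapP => -[].
Qed.

Definition ncount M A : nat := count (fun v => `[< A v >]) (verts M).

Lemma ncountE M A : \sum_(v <- verts M) (\1_A v)%:E = (ncount M A)%:R%:E :> \bar R.
Proof.
rewrite sumEFin; congr EFin; rewrite /ncount -sum1_count natr_sum [RHS]big_mkcond /=.
apply: eq_bigr => v _; rewrite indicE; case: asboolP => Av.
  by rewrite mem_set.
by rewrite memNset.
Qed.

Lemma depth_bound (r : seq (vertex d)) :
  exists M, forall v, v \in r -> (depth v <= M)%N.
Proof.
exists (\max_(v <- r) depth v) => v vr.
exact: leq_bigmax_seq.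
Qed.

Lemma ncount_counting A :
  (fun M => (ncount M A)%:R%:E : \bar R) @ \oo --> (counting A : \bar R).
Proof.
rewrite /counting; case: asboolP => [Afin|Ainf].
  have [M0 M0P] := depth_bound (finmap.enum_fset (fset_set A)).
  apply: cvg_near_cst; exists M0 => // M /= M0M; congr (_%:R%:E).
  rewrite /ncount -size_filter; apply: perm_size; apply: uniq_perm.
  - by rewrite filter_uniq// verts_uniq.
  - exact: finmap.fset_uniq.
  move=> v; rewrite mem_filter mem_verts in_fset_set//.
  apply/andP/idP => [[/asboolP Av _]|vA]; first exact: mem_set.
  split; first by apply/asboolP; exact: set_mem.
  by rewrite (leq_trans (M0P v _))// in_fset_set.
apply/cvgeyPge => a.
have [B BA nB] := @infinite_set_fset _ A (Num.truncn a).+1 Ainf.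
have [M0 M0P] := depth_bound (finmap.enum_fset B).
exists M0 => // M /= M0M; rewrite lee_fin.
apply: (@le_trans _ _ ((size (finmap.enum_fset B))%:R)).
  apply: (@le_trans _ _ ((Num.truncn a).+1%:R)); first by rewrite ltW// truncnS_gt.
  by rewrite ler_nat.
rewrite ler_nat /ncount -size_filter; apply: uniq_leq_size; first exact: finmap.fset_uniq.
move=> v vB; rewrite mem_filter mem_verts (leq_trans (M0P v vB))// andbT.
by apply/asboolP; exact: BA.
Qed.

Lemma ncount_le M N A : (M <= N)%N -> (ncount M A <= ncount N A)%N.
Proof.
move=> MN; rewrite /ncount -!size_filter; apply: uniq_leq_size.
  by rewrite filter_uniq// verts_uniq.
move=> v; rewrite !mem_filter !mem_verts => /andP[-> h] /=.
exact: leq_trans MN.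
Qed.

Lemma infinite_deep A : infinite_set A <->
  forall L, exists2 s, (L <= size s)%N & A (Some s).
Proof.
split=> [Ainf L|Adeep Afin].
  have [B BA nB] := @infinite_set_fset _ A (size (verts L)).+1 Ainf.
  apply: contrapT => H; move: nB; rewrite ltnNge => /negP; apply.
  apply: uniq_leq_size; first exact: finmap.fset_uniq.
  move=> v vB; rewrite mem_verts leqNgt; apply/negP => Lv; apply: H.
  case: v vB Lv => // s sB Ls; exists s; first exact: ltnW.
  exact: BA.
have [M MP] := depth_bound (finmap.enum_fset (fset_set A)).
have [s Ms As] := Adeep M.+1.
have := MP (Some s); rewrite in_fset_set// mem_set// => /(_ isT) /=.
by rewrite leqNgt Ms.
Qed.

End Counting.

Section BlueCount.
Context {R : realType} {d : nat}.
Variables (lam rho : R).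
Hypotheses (d0 : (0 < d)%N) (lam0 : 0 < lam) (rho0 : 0 < rho).
Context {disp : measure_display} {T : measurableType disp} (P : probability T R).
Variable X : R -> T -> vertex d -> color.
Hypothesis X_ced : is_ced lam rho P X.
Local Notation kernel := (@kernel R d lam rho).
Local Notation x0 := (@ced_init d).
Implicit Types (M N L n : nat) (s : seq 'I_d).
Local Open Scope ereal_scope.

Let ever v : set T := [set w | ever_blue X w v].

Lemma measurable_ever v : measurable (ever v).
Proof.
have [Y [S [mY mS law clock]]] := X_ced; exact: measurable_ever_blue mY mS clock v.
Qed.

Definition ever_sum M : \bar R := \sum_(s <- words M) P (ever (Some s)).

Lemma ever_sum_le M N : (M <= N)%N -> ever_sum M <= ever_sum N.
Proof.
move=> MN.
have h L : ever_sum L = (\sum_(s <- words L) fine (P (ever (Some s))))%:E.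
  rewrite -sumEFin; apply: eq_bigr => s _; rewrite fineK//.
  by apply: fin_num_measure; exact: measurable_ever.
by rewrite !h lee_fin; apply: sum_words_le => // s; rewrite fine_ge0.
Qed.

(** Monotone convergence for the number of blue vertices up to depth [M]. *)
Lemma expected_ever_blue_cvg :
  P (ever None) + ever_sum M @[M --> \oo] --> expected_ever_blue P X.
Proof.
pose g M w : \bar R := \sum_(v <- verts M) (\1_(ever v) w)%:E.
have gE M w : g M w = (ncount M (ever_blue X w))%:R%:E by rewrite -ncountE.
have m1 v : measurable_fun setT (fun w => (\1_(ever v) w)%:E : \bar R).
  by apply/measurable_EFinP; apply: measurable_indic; exact: measurable_ever.
have mg M : measurable_fun setT (g M) by apply: emeasurable_sum.
have -> : expected_ever_blue P X = \int[P]_w limn (g ^~ w).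
  apply: eq_integral => w _; apply/esym/cvg_lim => //.
  under eq_fun do rewrite gE.
  exact: ncount_counting.
have -> : (fun M => P (ever None) + ever_sum M) = (fun M => \int[P]_w g M w).
  apply/funext => M.
  rewrite (ge0_integral_sum P measurableT (f := fun v w => (\1_(ever v) w)%:E))//.
  rewrite /verts big_cons big_map integral_indic ?setIT//; last exact: measurable_ever.
  congr (_ + _); apply: eq_bigr => s _; rewrite integral_indic ?setIT//.
  exact: measurable_ever.
apply: cvg_monotone_convergence => //.
  by move=> M w _; rewrite gE.
by move=> w _ M N MN; rewrite !gE lee_fin ler_nat ncount_le.
Qed.

(** The expected number of blue vertices up to depth [M] at step [n] of the jump
chain, as a number that does not depend on the truncation depth [N] in
[kernel]. *)
Lemma blue_count_chain : exists a : nat -> nat -> R,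
  [/\ forall n M N, (n <= N)%N -> a n M = iter n (kernel N) (nblue M) x0,
      forall n M, (a n M)%:E <= ever_sum M
    & forall M, (a n M)%:E @[n --> \oo] --> ever_sum M].
Proof.
have [Y [S [mY mS law clock]]] := X_ced.
pose b n s := P [set w | Y n w (Some s) = blue].
have bE n s N : (n <= N)%N ->
    b n s = (iter n (kernel N) (fun y => (y (Some s) == blue)%:R) x0)%:E.
  move=> nN.
  have -> : (fun y : vertex d -> color => (y (Some s) == blue)%:R : R) =
      (fun y => `[< [set y | y (Some s) = blue] y >]%:R).
    apply/funext => y /=; suff -> : `[< y (Some s) = blue >] = (y (Some s) == blue) by [].
    by apply/asboolP/eqP.
  exact: (prob_chain lam0 rho0 mY mS law nN (mY n (Some s) blue)).
have sumb n M N : (n <= N)%N ->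
    \sum_(s <- words M) b n s = (iter n (kernel N) (nblue M) x0)%:E.
  move=> nN; rewrite iter_kernel_sum -sumEFin; apply: eq_bigr => s _; exact: bE.
have cvgM M : \sum_(s <- words M) b n s @[n --> \oo] --> ever_sum M.
  apply: cvg_nnesum => [s _|s _]; first by apply: nearW => n; exact: measure_ge0.
  exact: (prob_blue_cvg lam0 rho0 mY mS law clock).
exists (fun n M => iter n (kernel n) (nblue M) x0); split.
- by move=> n M N nN; apply/EFin_inj; rewrite -!sumb.
- move=> n M; rewrite -sumb//; apply: lee_sum => s _.
  exact: (prob_blue_le lam0 rho0 mY mS law clock n (Some s)).
- move=> M; under eq_fun do rewrite -sumb//.
  exact: cvgM.
Qed.

Lemma expected_lty_of_subcritical : subcritical d%:R lam rho ->
  expected_ever_blue P X < +oo.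
Proof.
move=> sub; have [C CP] := subcritical_nblue_bounded lam0 rho0 sub.
have [a [aE _ acvg]] := blue_count_chain.
have SC M : ever_sum M <= C%:E.
  rewrite -(cvg_lim _ (acvg M))//; apply: lime_le; first exact: cvgP (acvg M).
  apply: nearW => n; rewrite lee_fin (aE n M (maxn M n.+1).+1).
    exact: CP.
  by rewrite leqW// leq_max leqnSn orbT.
apply: (@le_lt_trans _ _ (1 + C%:E)); last by rewrite -EFinD ltry.
rewrite -(cvg_lim _ expected_ever_blue_cvg)//; apply: lime_le.
  exact: cvgP expected_ever_blue_cvg.
apply: nearW => M; apply: leeD => //; apply: probability_le1; exact: measurable_ever.
Qed.

(** By [at_least_critical_nblue_gap], up to every depth and at every step the
expected number of blue vertices is below its final value, for a sufficiently
large depth, by a fixed amount; so the final values are unbounded. *)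
Lemma expected_infty_of_at_least_critical : at_least_critical d%:R lam rho ->
  expected_ever_blue P X = +oo.
Proof.
move=> nc; have [c c0 cP] := at_least_critical_nblue_gap d0 lam0 rho0 nc.
have [a [aE aS acvg]] := blue_count_chain.
apply/eqP; rewrite -leye_eq leNgt; apply/negP => Efin.
have SE M : ever_sum M <= expected_ever_blue P X.
  rewrite -(cvg_lim _ expected_ever_blue_cvg)//; apply: lime_ge.
    exact: cvgP expected_ever_blue_cvg.
  exists M => // N /= MN; apply: le_trans (ever_sum_le MN) _.
  by rewrite leeDr// measure_ge0.
have S0 M : 0 <= ever_sum M by apply: sume_ge0 => s _; exact: measure_ge0.
pose sM M := fine (ever_sum M).
have sME M : ever_sum M = (sM M)%:E.
  by rewrite /sM fineK// ge0_fin_numE// (le_lt_trans (SE M)).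
have grow M n : (n < M)%N -> (a n M + c <= sM M)%R.
  move=> nM; apply/ler_addgt0Pr => e e0.
  have [m [N [nm mN MN h]]] := cP M n e nM e0.
  rewrite (aE n M N) ?(leq_trans nm (ltnW mN))//; apply: le_trans h _.
  by rewrite lerD2r -(aE m M N (ltnW mN)) -lee_fin -sME.
have step M : exists M', (sM M + c / 2 <= sM M')%R.
  have : (fun n => a n M) @ \oo --> sM M.
    by have := acvg M; rewrite sME => /fine_cvg.
  move=> /cvgr_gt/(_ (sM M - c / 2)%R) [|n _ /(_ n)].
    by rewrite ltrBlDr ltrDl divr_gt0.
  move=> /= /(_ (leqnn n)) h; exists (maxn M n.+1).
  have := grow (maxn M n.+1) n; rewrite leq_max leqnn orbT => /(_ isT).
  have : (a n M <= a n (maxn M n.+1))%R.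
    rewrite !(aE n _ n)//; apply: (iter_kernel_le lam0 rho0 n (@ced_init_reachable R d)).
    by move=> y _; apply: nblue_mono; rewrite leq_maxl.
  lra.
have iter_step k : exists M, (k%:R * (c / 2) <= sM M)%R.
  elim: k => [|k [M kM]]; first by exists 0%N; rewrite mul0r -lee_fin -sME.
  have [M' MM'] := step M; exists M'; apply: le_trans MM'.
  by rewrite -natr1 mulrDl mul1r lerD2r.
have Enum : expected_ever_blue P X \is a fin_num.
  by rewrite ge0_fin_numE//; apply: le_trans (S0 0%N) (SE 0%N).
pose K := (Num.truncn (fine (expected_ever_blue P X) / (c / 2))).+1.
have [M KM] := iter_step K.
have sK : (sM M <= fine (expected_ever_blue P X))%R.
  by rewrite -lee_fin -sME fineK.
have := le_trans KM sK.
apply/negP; rewrite -ltNge -ltr_pdivrMr ?divr_gt0//; exact: truncnS_gt.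
Qed.

Let deep_ever L : set T := \bigcup_(s in [set s | (L <= size s)%N]) ever (Some s).

Lemma measurable_deep_ever L : measurable (deep_ever L).
Proof.
rewrite /deep_ever bigcup_mkcond; apply: countable_bigcupT_measurable.
  exact: countableP.
by move=> s; case: ifP => _ //; exact: measurable_ever.
Qed.

Lemma infinitely_many_blueE : infinitely_many_blue X = \bigcap_L deep_ever L.
Proof.
apply/seteqP; split=> w /=.
  by move=> /infinite_deep h L _; have [s Ls ws] := h L; exists s.
by move=> h; apply/infinite_deep => L; have [s Ls ws] := h L I; exists s.
Qed.

Lemma measurable_infinitely_many_blue : measurable (infinitely_many_blue X).
Proof.
rewrite infinitely_many_blueE; apply: bigcapT_measurable => L.
exact: measurable_deep_ever.
Qed.

(** The events that some vertex of depth at least [L] turns blue decrease to the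
event in question, and their probabilities are bounded away from 0. *)
Lemma infinitely_many_blue_of_supercritical : supercritical d%:R lam rho ->
  P (infinitely_many_blue X) != 0.
Proof.
move=> sup; have [c c0 cP] := supercritical_deep d0 lam0 rho0 sup.
have [Y [S [mY mS law clock]]] := X_ced.
have Pdeep L : c%:E <= P (deep_ever L).
  have [n [N [nN cE]]] := cP L.
  pose DY := [set w | deep L (Y n w)].
  have DYE : DY = \bigcup_(s in [set s | (L <= size s)%N]) [set w | Y n w (Some s) = blue].
    apply/seteqP; split=> w /=; first by move=> [s Ls ws]; exists s.
    by move=> [s Ls ws]; exists s.
  have mDY : measurable DY.
    rewrite DYE bigcup_mkcond; apply: countable_bigcupT_measurable.
      exact: countableP.
    by move=> s; case: ifP => _ //; exact: mY.
  have PDY := prob_chain lam0 rho0 mY mS law (ltnW nN) mDY.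
  apply: (@le_trans _ _ (P DY)); first by rewrite PDY lee_fin.
  have [Z [mZ PZ ZZ]] := exceptional_null lam0 rho0 mY mS law.
  rewrite -(prob_setD_null mDY mZ PZ); apply: le_measure; rewrite ?inE.
  - exact: measurableD.
  - exact: measurable_deep_ever.
  - move=> w [[s Ls ws] Zw]; exists s => //.
    by apply: (blue_ever_blue lam0 rho0 mS clock _ ws) => /ZZ.
apply/negP => /eqP PB0.
have : P \o deep_ever @ \oo --> P (infinitely_many_blue X).
  rewrite infinitely_many_blueE; apply: nonincreasing_cvg_mu.
  - exact: le_lt_trans (probability_le1 P (measurable_deep_ever 0)) (ltry _).
  - exact: measurable_deep_ever.
  - by rewrite -infinitely_many_blueE; exact: measurable_infinitely_many_blue.
  - move=> L M LM; apply/subsetPset => w [s Ms ws]; exists s => //=.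
    exact: leq_trans Ms.
rewrite PB0 => Pcvg.
have : c%:E <= 0.
  rewrite -(cvg_lim _ Pcvg)//; apply: lime_ge; first exact: cvgP Pcvg.
  by apply: nearW => L; exact: Pdeep.
by rewrite leNgt lte_fin c0.
Qed.

Lemma finitely_many_blue_of_expected : expected_ever_blue P X < +oo ->
  P (infinitely_many_blue X) = 0.
Proof.
move=> Efin.
have f0 w : 0 <= (counting (ever_blue X w) : \bar R) by rewrite /counting; case: ifP.
have mf : measurable_fun setT (fun w => counting (ever_blue X w) : \bar R).
  apply: (emeasurable_fun_cvg (fun M w => (ncount M (ever_blue X w))%:R%:E)).
    move=> M; under eq_fun do rewrite -ncountE.
    apply: emeasurable_sum => v; apply/measurable_EFinP.
    by apply: measurable_indic; exact: measurable_ever.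
  by move=> w _; exact: ncount_counting.
have fint : P.-integrable setT (fun w => counting (ever_blue X w) : \bar R).
  apply/integrableP; split=> //.
  rewrite (eq_integral (fun w => counting (ever_blue X w)))//.
  by move=> w _; rewrite gee0_abs.
have [Z [mZ PZ ZZ]] := integrable_ae measurableT fint.
apply/eqP; rewrite eq_le measure_ge0 andbT -PZ le_measure ?inE//.
  exact: measurable_infinitely_many_blue.
move=> w wB; apply: ZZ => /(_ Logic.I).
by rewrite /counting asboolF.
Qed.

End BlueCount.

Theorem theorem2 (R : realType) (d : nat) (d_ge2 : (2 <= d)%N) (lam : R)
    (lam_in : lambda_c_minus d < lam < lambda_c_plus d)
    (disp : measure_display) (T : R -> measurableType disp)
    (P : forall rho : R, probability (T rho) R)
    (X : forall rho : R, R -> T rho -> vertex d -> color)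
    (X_ced : forall rho : R, 0 < rho -> is_ced lam rho (P rho) (X rho)) :
  (forall rho : R, (rho_c P X < rho%:E)%E ->
     (expected_ever_blue (P rho) (X rho) < +oo)%E) /\
  (forall rho : R, rho%:E = rho_c P X ->
     expected_ever_blue (P rho) (X rho) = +oo%E).
Proof.
have [lam0 Lambda] := Lambda_interval d_ge2 lam_in.
have d0 : (0 < d)%N by exact: ltnW.
have dR : 0 < d%:R :> R by rewrite ltr0n.
have not_super rho : 0 < rho -> P rho (infinitely_many_blue (X rho)) = 0%E ->
    ~ supercritical d%:R lam rho.
  move=> rho0 PB /(infinitely_many_blue_of_supercritical d0 lam0 rho0 (X_ced rho rho0)).
  by rewrite PB eqxx.
split=> rho.
  move=> /ereal_inf_lt[_ [rho' [rho'0 PB] <-]]; rewrite lte_fin => rho'rho.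
  have rho0 : 0 < rho by exact: lt_trans rho'rho.
  apply: (expected_lty_of_subcritical lam0 rho0 (X_ced rho rho0)).
  have [[e e0 sub]|nc] := subcritical_or_at_least_critical dR lam0 rho0.
    by apply: sub; rewrite lexx andbT ltrBlDr ltrDl.
  case: (not_super _ rho'0 PB); apply: supercritical_of_lower_death nc => //.
  by rewrite rho'0.
move=> rhoE; have [r r0 super] : exists2 r : R, 0 < r &
    forall rho, 0 < rho < r -> supercritical d%:R lam rho.
  by apply: supercritical_small_death => //; rewrite ler1n.
(* The processes are specified for positive death rates only. *)
have rho0 : 0 < rho.
  apply: (lt_le_trans r0); rewrite -lee_fin rhoE.
  apply/ereal_infP => _ [rho' [rho'0 PB] <-]; rewrite lee_fin leNgt.
  by apply/negP => rho'r; case: (not_super _ rho'0 PB); apply: super; rewrite rho'0.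
have [[e e0 sub]|nc] := subcritical_or_at_least_critical dR lam0 rho0; last first.
  exact: (expected_infty_of_at_least_critical d0 lam0 rho0 (X_ced rho rho0) nc).
exfalso.
pose rho' := Num.max (rho - e / 2) (rho / 2).
have rho'0 : 0 < rho' by rewrite lt_max divr_gt0 ?orbT.
have rho'rho : rho' < rho.
  by rewrite gt_max ltrBlDr ltrDl divr_gt0//= ltr_pdivrMr// ltr_pMr// ltr1n.
have sub' : subcritical d%:R lam rho'.
  apply: sub; rewrite (ltW rho'rho) andbT; apply: (@lt_le_trans _ _ (rho - e / 2)).
    by rewrite ltrD2l ltrN2 ltr_pdivrMr// ltr_pMr// ltr1n.
  by rewrite le_max lexx.
have PB : P rho' (infinitely_many_blue (X rho')) = 0%E.
  apply: (finitely_many_blue_of_expected (X_ced rho' rho'0)).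
  exact: (expected_lty_of_subcritical lam0 rho'0 (X_ced rho' rho'0)).
have : (rho_c P X <= rho'%:E)%E by apply: ereal_inf_lbound; exists rho'.
by rewrite -rhoE lee_fin leNgt rho'rho.
Qed.
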